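(* Let $1\le m\le n-1$ be integers, let $E\subset\mathbb{R}^n$ be a non-empty compact set and let $0\le s\le m$. Then $$\dim_{\rm H}\big\{V\in G(n,m):\ \overline{\dim}_{\rm B}\,\pi_VE<\overline{\dim}_{\rm B}^{\,s}E\big\}\le m(n-m)-(m-s),$$ and $$\dim_{\rm H}\big\{V\in G(n,m):\ \underline{\dim}_{\rm B}\,\pi_VE<\underline{\dim}_{\rm B}^{\,s}E\big\}\le m(n-m)-(m-s).$$
   Context: $G(n,m)$ is the Grassmannian of $m$-dimensional linear subspaces of $\mathbb{R}^n$, a manifold of dimension $m(n-m)$, and $\pi_V:\mathbb{R}^n\to V$ is orthogonal projection. $\dim_{\rm H}$ denotes Hausdorff dimension, taken in $G(n,m)$ with respect to a natural locally $m(n-m)$-dimensional metric, for example $d(V,W)=\|\pi_V-\pi_W\|$ (operator norm); the empty set has dimension $0$. For $s\ge0$ and $r>0$ let $\phi_r^s(x)=\min\{1,(r/|x|)^s\}$ for $x\in\mathbb{R}^n$ (with $\phi_r^s(0)=1$, and $\phi_r^0\equiv1$). For non-empty compact $E\subset\mathbb{R}^n$ let $\mathcal{M}(E)$ be the set of Borel probability measures supported by $E$. The capacity $C_r^s(E)$ is defined by $$\frac{1}{C_r^s(E)}=\inf_{\mu\in\mathcal{M}(E)}\int\int\phi_r^s(x-y)\,d\mu(x)\,d\mu(y).$$ The lower and upper $s$-box dimension profiles of $E$ are $$\underline{\dim}_{\rm B}^{\,s}E=\liminf_{r\to0}\frac{\log C_r^s(E)}{-\log r},\qquad \overline{\dim}_{\rm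 B}^{\,s}E=\limsup_{r\to0}\frac{\log C_r^s(E)}{-\log r}.$$ For a non-empty compact set $A$ in a Euclidean space let $N_r(A)$ be the minimum number of sets of diameter $r$ that can cover $A$. The lower and upper box-counting dimensions of $A$ are $$\underline{\dim}_{\rm B}A=\liminf_{r\to0}\frac{\log N_r(A)}{-\log r},\qquad \overline{\dim}_{\rm B}A=\limsup_{r\to0}\frac{\log N_r(A)}{-\log r}.$$ *)

(* Defs.v *)
From HB Require Import structures.
From mathcomp Require Import all_boot all_order all_algebra.
From mathcomp Require Import all_classical all_reals all_analysis.

Set Implicit Arguments.
Unset Strict Implicit.
Unset Printing Implicit Defensive.

Import Order.TTheory GRing.Theory Num.Theory.
Import numFieldNormedType.Exports.

Local Open Scope classical_set_scope.
Local Open Scope ring_scope.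

(* R^n is ['rV[R]_n], whose library topology is the Euclidean one.  The norm
   [`|x|] of the library on ['rV[R]_n] is the sup norm, hence [enorm]. *)

Definition dotv (R : realType) (n : nat) (x y : 'rV[R]_n) : R :=
  \sum_(i < n) x 0 i * y 0 i.

Definition enorm (R : realType) (n : nat) (x : 'rV[R]_n) : R :=
  Num.sqrt (dotv x x).

Definition edist (R : realType) (n : nat) (x y : 'rV[R]_n) : R :=
  enorm (x - y).

(* The orthogonal complement, as the kernel of x |-> (x . b_i)_i, where
   (b_i)_i is a basis of V; see [orthvP]. *)
Definition orthv (R : realType) (n : nat) (V : {vspace 'rV[R]_n}) :
    {vspace 'rV[R]_n} :=
  lker (linfun (mulmxr (\matrix_(i < \dim V) (vbasis V)`_i)^T)
        : 'Hom('rV[R]_n, 'rV[R]_(\dim V))).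

Definition orthoproj (R : realType) (n : nat) (V : {vspace 'rV[R]_n}) :
    'End('rV[R]_n) := daddv_pi V (orthv V).

Lemma dotvC (R : realType) (n : nat) (x y : 'rV[R]_n) : dotv x y = dotv y x.
Proof. by apply: eq_bigr => i _; rewrite mulrC. Qed.

Lemma dotvDr (R : realType) (n : nat) (x y z : 'rV[R]_n) :
  dotv x (y + z) = dotv x y + dotv x z.
Proof.
by rewrite -big_split; apply: eq_bigr => i _ /=; rewrite !mxE mulrDr.
Qed.

Lemma dotvZr (R : realType) (n : nat) (x y : 'rV[R]_n) (a : R) :
  dotv x (a *: y) = a * dotv x y.
Proof.
by rewrite mulr_sumr; apply: eq_bigr => i _; rewrite !mxE mulrCA.
Qed.

Lemma dotv0r (R : realType) (n : nat) (x : 'rV[R]_n) : dotv x 0 = 0.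
Proof. by apply: big1 => i _; rewrite mxE mulr0. Qed.

Lemma dotv_eq0 (R : realType) (n : nat) (x : 'rV[R]_n) :
  dotv x x = 0 -> x = 0.
Proof.
move=> /eqP; rewrite psumr_eq0 => [/allP x0|i _]; last by rewrite -expr2 sqr_ge0.
apply/rowP => i; rewrite mxE; apply/eqP.
by have := x0 i (mem_index_enum i); rewrite /= mulf_eq0 orbb.
Qed.

Lemma orthvP (R : realType) (n : nat) (V : {vspace 'rV[R]_n}) (x : 'rV[R]_n) :
  (x \in orthv V) <-> (forall v, v \in V -> dotv x v = 0).
Proof.
rewrite /orthv memv_ker lfunE /=.
have mulE i : (x *m (\matrix_(i < \dim V) (vbasis V)`_i)^T) 0 i
            = dotv x (vbasis V)`_i.
  by rewrite mxE; apply: eq_bigr => j _; rewrite !mxE.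
split => [/eqP/rowP x0 v vV|x0].
  rewrite (coord_vbasis vV).
  elim/big_rec : _ => [|i y _ y0]; first exact: dotv0r.
  by rewrite dotvDr dotvZr y0 addr0 -mulE x0 mxE mulr0.
apply/eqP/rowP => i; rewrite mulE mxE; apply: x0.
by apply/vbasis_mem/mem_nth; rewrite size_tuple.
Qed.

Lemma capv_orthv (R : realType) (n : nat) (V : {vspace 'rV[R]_n}) :
  (V :&: orthv V = 0)%VS.
Proof.
apply/eqP; rewrite -subv0; apply/subvP => x; rewrite memv_cap => /andP[xV].
by move=> /orthvP/(_ x xV)/dotv_eq0 ->; exact: mem0v.
Qed.

Lemma addv_orthv (R : realType) (n : nat) (V : {vspace 'rV[R]_n}) :
  (V + orthv V = fullv)%VS.
Proof.
apply/eqP; rewrite eqEdim subvf /=.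
rewrite dimv_disjoint_sum ?capv_orthv//.
set f : 'Hom('rV[R]_n, 'rV[R]_(\dim V)) :=
  linfun (mulmxr (\matrix_(i < \dim V) (vbasis V)`_i)^T).
have := limg_ker_dim f fullv; rewrite capfv => <-.
rewrite addnC -[lker f]/(orthv V) leq_add2r (leq_trans (dimvS (subvf _)))//.
by rewrite dimvf /dim /= mul1n.
Qed.

Lemma orthoproj_mem (R : realType) (n : nat) (V : {vspace 'rV[R]_n})
  (x : 'rV[R]_n) : orthoproj V x \in V.
Proof. exact: memv_pi. Qed.

Lemma orthoproj_orth (R : realType) (n : nat) (V : {vspace 'rV[R]_n})
  (x v : 'rV[R]_n) : v \in V -> dotv (x - orthoproj V x) v = 0.
Proof.
move=> vV; have xVV : (x \in V + orthv V)%VS by rewrite addv_orthv memvf.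
have /(orthvP V) -> // : x - orthoproj V x \in orthv V.
rewrite -[X in X - _](daddv_pi_add (capv_orthv V) xVV).
by rewrite /orthoproj addrAC subrr add0r; exact: memv_pi.
Qed.

Definition opnorm (R : realType) (n : nat) (f : 'End('rV[R]_n)) : R :=
  sup [set enorm (f x) | x in [set x : 'rV[R]_n | enorm x <= 1]].

Definition grassmannian (R : realType) (n m : nat) : Type :=
  {V : {vspace 'rV[R]_n} | \dim V == m}.

Definition grass_dist (R : realType) (n m : nat) (V W : grassmannian R n m) :
    R := opnorm (orthoproj (sval V) - orthoproj (sval W)).

Section hausdorff.
Local Open Scope ereal_scope.

(* The element 0 is added so that the empty set has diameter 0. *)
Definition diam (R : realType) (T : Type) (d : T -> T -> R) (A : set T) :
    \bar R :=
  ereal_sup (0 |` [set (d p.1 p.2)%:E | p in A `*` A]).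

(* |A|^t, with |A|^0 = 1 for A nonempty, and 0 for A empty, also if t = 0. *)
Definition diam_pow (R : realType) (T : Type) (d : T -> T -> R) (t : R)
    (A : set T) : \bar R :=
  if A == set0 then 0 else poweR (diam d A) t.

Definition hausdorff_premeasure (R : realType) (T : Type) (d : T -> T -> R)
    (t delta : R) (A : set T) : \bar R :=
  ereal_inf [set \sum_(0 <= i <oo) diam_pow d t (U i) |
    U in [set U : (set T)^nat |
      A `<=` \bigcup_i U i /\ forall i, diam d (U i) <= delta%:E]].

(* The limit as delta -> 0+ is a supremum by monotonicity in delta. *)
Definition hausdorff_measure (R : realType) (T : Type) (d : T -> T -> R)
    (t : R) (A : set T) : \bar R :=
  ereal_sup [set hausdorff_premeasure d t delta A |
    delta in [set delta : R | (0 < delta)%R]].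

Definition hausdorff_dim (R : realType) (T : Type) (d : T -> T -> R)
    (A : set T) : \bar R :=
  ereal_inf [set t%:E |
    t in [set t : R | (0 <= t)%R /\ hausdorff_measure d t A = 0]].

End hausdorff.

Definition phi (R : realType) (n : nat) (r s : R) (x : 'rV[R]_n) : R :=
  if x == 0 then 1 else Num.min 1 ((r / enorm x) `^ s).

Definition borel_rV (R : realType) (n : nat) :=
  g_sigma_algebraType (@open 'rV[R]_n).

Section dimensions.
Local Open Scope ereal_scope.

Definition probs_on (R : realType) (n : nat) (E : set 'rV[R]_n) :
    set (probability (borel_rV R n) R) :=
  [set mu : probability (borel_rV R n) R | mu (~` E) = 0].

Definition energy (R : realType) (n : nat) (r s : R)
    (mu : probability (borel_rV R n) R) : \bar R :=
  \int[mu]_y \int[mu]_x (phi r s ((x : 'rV[R]_n) - (y : 'rV[R]_n))%R)%:E.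

Definition capacity (R : realType) (n : nat) (r s : R) (E : set 'rV[R]_n) :
    \bar R :=
  (ereal_inf [set energy r s mu | mu in probs_on E])^-1.

Definition lower_profile (R : realType) (n : nat) (s : R) (E : set 'rV[R]_n) :
    \bar R :=
  limf_einf (fun r : R => lne (capacity r s E) / (- ln r)%R%:E) 0%R^'+.

Definition upper_profile (R : realType) (n : nat) (s : R) (E : set 'rV[R]_n) :
    \bar R :=
  limf_esup (fun r : R => lne (capacity r s E) / (- ln r)%R%:E) 0%R^'+.

(* As an infimum of natural numbers in [\bar R]; it is a minimum as soon as
   some finite cover exists, and +oo otherwise. *)
Definition covering_number (R : realType) (n : nat) (r : R)
    (A : set 'rV[R]_n) : \bar R :=
  ereal_inf [set k%:R%:E | k in [set k : nat |
    exists U : 'I_k -> set 'rV[R]_n,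
      (forall i, diam (@edist R n) (U i) = r%:E) /\
      (forall x, A x -> exists i, U i x)]].

Definition lower_box_dim (R : realType) (n : nat) (A : set 'rV[R]_n) :
    \bar R :=
  limf_einf (fun r : R => lne (covering_number r A) / (- ln r)%R%:E) 0%R^'+.

Definition upper_box_dim (R : realType) (n : nat) (A : set 'rV[R]_n) :
    \bar R :=
  limf_esup (fun r : R => lne (covering_number r A) / (- ln r)%R%:E) 0%R^'+.

End dimensions.

(* Main.v *)
Require Import Defs.
From HB Require Import structures.
From mathcomp Require Import all_boot all_order all_algebra.
From mathcomp Require Import all_classical all_reals all_analysis.
From mathcomp Require Import measurable_realfun.
From mathcomp Require Import ring lra zify.

Import Order.TTheory GRing.Theory Num.Theory.
Import numFieldNormedType.Exports.

Local Open Scope ring_scope.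

(** For reals a < b, a subspace V with dim_B (pi_V E) < a and b < dim_B^s E is
    bad at infinitely many scales r of a sequence that decreases at least
    geometrically: pi_V E is covered by O(r^-a) sets of diameter at most r,
    although some probability measure mu on E has energy at most r^b.  The
    exceptional set is the union of the corresponding limsup sets over rational
    a < b, so it is enough to show, for t > m(n-m-1) + s, that the set F of the
    subspaces that are bad at scale r has a cover with sum of diam^t at most
    C r^(b-a).  These bounds are summable, so that H^t vanishes on the limsup
    set ([coverable_limsup]).

    To bound the content of F, take weights w on a finite r-net of F with
    w(B(V, rho)) <= rho^t whenever rho >= r.  If w is maximal, then every point
    of the net lies in a ball where equality holds, and by a Vitali selection
    disjoint balls of this kind, enlarged, cover F; hence the content of F is
    at most a constant times the mass of w ([finite_frostman]).  This is
    Frostman's lemma at a single scale.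

    The mass of w is bounded by the energy of mu.  On the one hand, the
    subspaces with |pi_V x| <= delta |x| lie near a submanifold of codimension
    m of the Grassmannian, so they are covered by O(delta^(-m(n-m-1))) sets of
    diameter O(delta) ([slab_key]); with delta = r/|x| and t >= m(n-m-1) + s
    this gives w{V : |pi_V x| <= r} <= C phi_r^s(x) ([slab_weight]).  On the
    other hand, if pi_V E is covered by M sets of diameter at most r, then half
    of the mass of mu is carried by points y for which the slab
    {x : |pi_V (x - y)| <= r} has mass at least 1/(2M) ([heavy_part]).  Summing
    over V with the weights w and integrating yields
    w(F) <= 4 M C energy = O(r^-a r^b) ([sum_weights_le_energy]).

    The covering bound for slabs is obtained in coordinates.  Choosing a
    maximal minor, V is the graph of a linear map over m of the coordinate
    axes, with matrix entries bounded by 1 ([exists_chart]).  The condition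
    |pi_V x| <= delta |x| is one approximate linear equation for each of the m
    rows of that matrix, and determines one entry of the row up to O(delta)
    from the others ([slab_entries]). *)

(** * Maximal weights and finite coverings *)

(** Greedy construction: the points are treated one after the other, and the
    weight of each is raised until some constraint that contains it becomes
    tight.  A tight constraint stays tight, since no weight decreases. *)
Lemma tight_weights (R : realType) (I J : finType) (S : J -> {set I})
    (kap : J -> R) :
  (forall j, 0 <= kap j) -> (forall i, exists j, i \in S j) ->
  exists w : I -> R, [/\ forall i, 0 <= w i,
    forall j, \sum_(i in S j) w i <= kap j &
    forall i, exists2 j, i \in S j & \sum_(i in S j) w i = kap j].
Proof.
move=> kap0 cov.
suff step (s : seq I) : exists w : I -> R, [/\ forall i, 0 <= w i,
    forall j, \sum_(i in S j) w i <= kap j &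
    forall i, i \in s -> exists2 j, i \in S j & \sum_(i in S j) w i = kap j].
  have [w [w0 wk wt]] := step (enum I).
  by exists w; split => // i; apply: wt; rewrite mem_enum.
elim: s => [|i s [w [w0 wk wt]]].
  by exists (fun=> 0); split => // j; rewrite big1.
have [j0 ij0] := cov i.
pose slack j := kap j - \sum_(i in S j) w i.
case: (arg_minP (P := fun j => i \in S j) slack ij0) => j ij jmin.
have slack0 j' : 0 <= slack j' by rewrite subr_ge0.
pose w' k := w k + slack j * (k == i)%:R.
have sumw' j' :
    \sum_(k in S j') w' k = \sum_(k in S j') w k + slack j * (i \in S j')%:R.
  rewrite big_split /= -mulr_sumr; congr (_ + _ * _).
  have [ij'|ij'] := boolP (i \in S j').
    rewrite (bigD1 i)//= eqxx big1 ?addr0// => k /andP[_ /negbTE ->].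
    by [].
  rewrite big1// => k kS; case: eqP => // ki.
  by rewrite -ki kS in ij'.
exists w'; split.
- by move=> k; rewrite /w' addr_ge0// mulr_ge0// slack0.
- move=> j'; rewrite sumw'; have [ij'|ij'] := boolP (i \in S j').
    by have := jmin _ ij'; rewrite /slack mulr1; lra.
  by rewrite mulr0 addr0.
- move=> k; rewrite inE => /predU1P[->|/wt[j' kj' tj']].
    by exists j => //; rewrite sumw' ij mulr1 /slack addrC subrK.
  exists j' => //; rewrite sumw' tj'.
  have [ij'|ij'] := boolP (i \in S j'); last by rewrite mulr0 addr0.
  have slackj' : slack j' = 0 by rewrite /slack tj' subrr.
  have /eqP -> : slack j == 0 by rewrite eq_le slack0 -slackj' jmin.
  by rewrite mul0r addr0.
Qed.

(** The largest ball is selected, and those that meet it are discarded; then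
    the argument is repeated.  Each ball was discarded by one at least as
    large. *)
Lemma vitali_finite (R : realType) (I K : finType) (B : K -> {set I})
    (rad : K -> R) :
  (forall k, B k != finset.set0) ->
  exists D : {set K},
    (forall k k', k \in D -> k' \in D -> k != k' -> [disjoint B k & B k']) /\
    forall k, exists k',
      [/\ k' \in D, rad k <= rad k' & ~~ [disjoint B k & B k']].
Proof.
move=> B0.
suff step N (S : {set K}) : (#|S| <= N)%N -> exists D : {set K},
    [/\ D \subset S,
    forall k k', k \in D -> k' \in D -> k != k' -> [disjoint B k & B k'] &
    forall k, k \in S -> exists k',
      [/\ k' \in D, rad k <= rad k' & ~~ [disjoint B k & B k']]].
  have [D [_ D1 D2]] := step _ finset.setT (leqnn _).
  by exists D; split => // k; apply: D2; rewrite inE.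
elim: N S => [|N IH] S.
  rewrite leqn0 cards_eq0 => /eqP ->; exists finset.set0.
  by split => // [k k'|k]; rewrite inE.
move=> SN; have [->|[k1 k1S]] := set_0Vmem S.
  by exists finset.set0; split => // [k k'|k]; rewrite inE.
case: (arg_maxP (P := fun k => k \in S) rad k1S) => {k1S} k kS kmax.
pose S' := [set k' in S | [disjoint B k & B k']]%SET.
have [|D' [D'S D'1 D'2]] := IH S'.
  rewrite -ltnS (leq_trans _ SN)//; apply: proper_card.
  apply/properP; split; first by apply/fintype.subsetP => x; rewrite inE => /andP[].
  exists k => //; rewrite inE kS /= -setI_eq0 finset.setIid; exact: B0.
have D'P x : x \in D' -> (x \in S) && [disjoint B k & B x].
  by move=> /(fintype.subsetP D'S); rewrite inE.
exists (k |: D')%SET; split.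
- apply/fintype.subsetP => x; rewrite !inE => /predU1P[->//|/D'P/andP[]//].
- move=> x y; rewrite !inE => /predU1P[->|xD] /predU1P[->|yD].
  + by rewrite eqxx.
  + by move=> _; have /andP[] := D'P _ yD.
  + by move=> _; rewrite disjoint_sym; have /andP[] := D'P _ xD.
  + exact: D'1.
- move=> x xS; have [dx|ndx] := boolP [disjoint B k & B x].
    have [|k' [k'D rk' nd]] := D'2 x; first by rewrite inE xS.
    by exists k'; rewrite !inE k'D orbT.
  by exists k; rewrite !inE eqxx disjoint_sym; split => //; apply: kmax.
Qed.

(** Frostman's lemma on a finite set, at scales at least r.  A ball with
    centre q contains the same points as the ball whose radius is the largest
    distance from q that it attains, so that the radii max(r, d(q, j)) give
    finitely many constraints which imply the bound at every scale.  The
    selected balls are disjoint and tight, hence the sum of their rad^t is at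
    most the total weight. *)
Lemma finite_frostman (R : realType) (I : finType) (d : I -> I -> R) (t r : R) :
  (forall i, d i i = 0) -> (forall i j, d i j = d j i) ->
  (forall i j k, d i k <= d i j + d j k) -> 0 <= t -> 0 < r ->
  exists w : I -> R, [/\ forall i, 0 <= w i,
    forall q rho, r <= rho -> \sum_(i | d q i <= rho) w i <= rho `^ t &
    exists (K : finType) (c : K -> I) (rad : K -> R),
    [/\ forall k, r <= rad k, \sum_k rad k `^ t <= \sum_i w i &
        forall i, exists k, d (c k) i <= 3 * rad k]].
Proof.
move=> d0 dC dtri t0 r0.
pose S (c : I * I) : {set I} :=
  [set i | d c.1 i <= Num.max r (d c.1 c.2)]%SET.
pose rd (c : I * I) := Num.max r (d c.1 c.2).
have rd_ge c : r <= rd c by rewrite le_max lexx.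
have rd0 c : 0 <= rd c by rewrite (le_trans (ltW r0)).
have [||w [w0 wk wt]] := @tight_weights R I _ S (fun c => rd c `^ t).
- by move=> c; exact: powR_ge0.
- by move=> i; exists (i, i); rewrite inE /= d0 le_max ltW.
exists w; split => //.
  move=> q rho rrho.
  have Pq : d q q <= rho by rewrite d0 (le_trans (ltW r0)).
  case: (arg_maxP (P := fun j => d q j <= rho) (d q) Pq) => j jrho jmax.
  rewrite (eq_bigl (fun i => i \in S (q, j))).
    apply: (le_trans (wk _)); rewrite ge0_ler_powR// ?nnegrE//.
      by rewrite (le_trans (ltW r0)).
    by rewrite ge_max rrho.
  move=> i; rewrite inE /=; apply/idP/idP => [/jmax dij|/le_trans]; last first.
    by apply; rewrite ge_max rrho.
  by rewrite le_max; apply/orP; right.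
have [f ft] : {f : I -> I * I & forall i, i \in S (f i) /\
    \sum_(k in S (f i)) w k = rd (f i) `^ t}.
  by apply: (@choice _ _ (fun i c => i \in S c /\
    \sum_(k in S c) w k = rd c `^ t)) => i; have [c] := wt i; exists c.
have [|D [Ddisj Dcov]] := @vitali_finite R _ _ (fun i => S (f i)) (rd \o f).
  by move=> i; apply/set0Pn; exists i; case: (ft i).
exists {x | x \in D}, (fun k => (f (val k)).1), (fun k => rd (f (val k))).
split.
- by move=> k; exact: rd_ge.
- under eq_bigr => k _ do rewrite -(ft (val k)).2.
  rewrite -partition_disjoint_bigcup.
    rewrite big_mkcond/=; apply: ler_sum => i _; case: ifP => // _.
  by move=> k k' kk'; apply: Ddisj; rewrite ?(valP k) ?(valP k')// (inj_eq val_inj).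
- move=> i; have [k [kD rk nd]] := Dcov i.
  exists (Sub k kD) => /=.
  move: nd; rewrite -setI_eq0 => /set0Pn[x]; rewrite !inE => /andP[].
  rewrite -/(rd _) -/(rd _) => xi xk.
  have := (ft i).1; rewrite inE -/(rd _) => ii.
  have h1 := dtri (f k).1 x i; have h2 := dtri x (f i).1 i.
  by rewrite (dC x (f i).1) in h2; rewrite /= in rk; lra.
Qed.

Local Open Scope classical_set_scope.
Local Open Scope ring_scope.

(** * Coverings and Hausdorff measure zero *)

(** An upper bound eps for [hausdorff_premeasure] that is attained by a cover;
    a real bound attained by a cover is easier to combine than an infimum. *)
Definition coverable {R : realType} {T : Type} (d : T -> T -> R)
    (t delta eps : R) (A : set T) : Prop :=
  exists U : (set T)^nat, [/\ A `<=` \bigcup_i U i,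
    forall i, (diam d (U i) <= delta%:E)%E &
    (\sum_(0 <= i <oo) diam_pow d t (U i) <= eps%:E)%E].

Lemma diam_ge0 {R : realType} {T : Type} (d : T -> T -> R) (A : set T) :
  (0 <= diam d A)%E.
Proof. by apply: ereal_sup_ubound; left. Qed.

Lemma diam_pow_ge0 {R : realType} {T : Type} (d : T -> T -> R) (t : R)
  (A : set T) : (0 <= diam_pow d t A)%E.
Proof. by rewrite /diam_pow; case: ifP => // _; exact: poweR_ge0. Qed.

Lemma coverable_sub {R : realType} {T : Type} (d : T -> T -> R)
    (t delta eps : R) (A B : set T) :
  A `<=` B -> coverable d t delta eps B -> coverable d t delta eps A.
Proof.
by move=> AB [U [BU dU sU]]; exists U; split => //; apply: subset_trans BU.
Qed.

Lemma coverable_bigcup {R : realType} {T : Type} (d : T -> T -> R)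
    (t delta eps : R) (A : (set T)^nat) (e : R^nat) :
  (forall n, coverable d t delta (e n) (A n)) ->
  (\sum_(0 <= n <oo) (e n)%:E <= eps%:E)%E ->
  coverable d t delta eps (\bigcup_n A n).
Proof.
move=> /choice[U UP] se.
have /card_esym/ppcard_eqP[f] := card_nat2.
pose V p := U p.1 p.2.
have V0 p : (0 <= diam_pow d t (V p))%E by exact: diam_pow_ge0.
exists (V \o f); split.
- move=> x [n _ Ax]; have [/(_ x Ax)[i _ Ux] _ _] := UP n.
  by exists (f^-1%FUN (n, i)) => //=; rewrite invK ?inE.
- by move=> i; have [_ ->] := UP (f i).1.
- apply: le_trans se; rewrite nneseries_esumT//=.
  rewrite -(reindex_esum setT setT f (fun p => diam_pow d t (V p)))//.
  rewrite (_ : setT = [set: nat] `*`` fun=> setT); last first.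
    by apply/seteqP; split.
  rewrite -(@esum_esum _ _ _ _ _ (fun n i => diam_pow d t (U n i)))//; last first.
    by move=> *; exact: diam_pow_ge0.
  rewrite -nneseries_esumT//; last first.
    by move=> i; apply: esum_ge0 => *; exact: diam_pow_ge0.
  apply: lee_nneseries => n _.
    by move=> _; apply: esum_ge0 => *; exact: diam_pow_ge0.
  rewrite -nneseries_esumT//; last by move=> *; exact: diam_pow_ge0.
  by have [] := UP n.
Qed.

Lemma diam_pow_le {R : realType} {T : Type} (d : T -> T -> R) (t rho : R)
    (A : set T) :
  0 <= t -> 0 <= rho -> (forall x y, A x -> A y -> d x y <= rho) ->
  (diam d A <= rho%:E)%E /\ (diam_pow d t A <= (rho `^ t)%:E)%E.
Proof.
move=> t0 rho0 Arho.
have dA : (diam d A <= rho%:E)%E.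
  apply: ge_ereal_sup => _ [->|[[x y] [Ax Ay] <-]]; rewrite lee_fin//.
  exact: Arho.
split => //; rewrite /diam_pow; case: ifP => _.
  by rewrite lee_fin powR_ge0.
rewrite -poweR_EFin gt0_ler_poweR// in_itv/= ?leey ?andbT ?lee_fin//.
exact: diam_ge0.
Qed.

(** Finite families become sequences by padding with the empty set, whose
    [diam_pow] is 0 for all t. *)
Lemma coverable_fin {R : realType} {T : Type} (d : T -> T -> R)
    (t delta eps : R) (A : set T) (K : finType) (U : K -> set T) (rad : K -> R) :
  0 <= t -> 0 <= delta -> (forall k, 0 <= rad k <= delta) ->
  (forall k x y, U k x -> U k y -> d x y <= rad k) ->
  A `<=` \bigcup_k U k -> \sum_k rad k `^ t <= eps ->
  coverable d t delta eps A.
Proof.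
move=> t0 delta0 radP dU AU sumrad.
pose V i := if insub i : option 'I_#|K| is Some j then U (enum_val j) else set0.
have V_ord (j : 'I_#|K|) : V j = U (enum_val j) by rewrite /V valK.
have V_big i : (#|K| <= i)%N -> V i = set0.
  by move=> Ki; rewrite /V insubF// ltnNge Ki.
exists V; split.
- move=> x /AU[k _ Ux]; exists (enum_rank k) => //.
  by rewrite V_ord enum_rankK.
- move=> i; have [Ki|iK] := leqP #|K| i.
    rewrite (V_big _ Ki).
    by have [|/le_trans + _] := diam_pow_le d 0 0 set0 (lexx 0) (lexx 0); [|apply].
  have -> : i = Ordinal iK by []; rewrite V_ord.
  have /andP[r0 rd] := radP (enum_val (Ordinal iK)).
  have [+ _] := diam_pow_le d t _ _ t0 r0 (dU (enum_val (Ordinal iK))).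
  by move=> /le_trans; apply; rewrite lee_fin.
- rewrite (nneseries_split 0 #|K|); last by move=> *; exact: diam_pow_ge0.
  rewrite [X in (_ + X)%E]eseries0 ?adde0; last first.
    by move=> i; rewrite add0n => Ki _; rewrite (V_big _ Ki) /diam_pow eqxx.
  rewrite add0n big_mkord.
  apply: (@le_trans _ _ (\sum_(j < #|K|) (rad (enum_val j) `^ t)%:E)%E).
    apply: lee_sum => j _; rewrite V_ord.
    have /andP[r0 rd] := radP (enum_val j).
    by apply: (diam_pow_le d t _ _ t0 r0 (dU _)).2.
  rewrite sumEFin lee_fin (le_trans _ sumrad)//.
  by rewrite -(big_enum_val (fun k => rad k `^ t)).
Qed.

Lemma hausdorff_measure_eq0 {R : realType} {T : Type} (d : T -> T -> R)
    (t : R) (A : set T) :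
  (forall delta eps, 0 < delta -> 0 < eps -> coverable d t delta eps A) ->
  hausdorff_measure d t A = 0.
Proof.
move=> Acov; apply/eqP; rewrite eq_le; apply/andP; split; last first.
  apply: le_trans (ereal_sup_ubound _); last by exists 1 => //=.
  apply: le_ereal_inf_tmp => _ [U _ <-].
  by apply: nneseries_ge0 => *; exact: diam_pow_ge0.
apply: ge_ereal_sup => _ [delta /= delta0 <-].
apply/lee_addgt0Pr => e e0; rewrite add0e.
have [U [AU dU sU]] := Acov _ _ delta0 e0.
by apply: le_trans sU; apply: ereal_inf_lbound; exists U.
Qed.

Lemma coverable_bigcup_null {R : realType} {T : Type} (d : T -> T -> R)
    (t delta eps : R) (A : (set T)^nat) : 0 < eps ->
  (forall n e, 0 < e -> coverable d t delta e (A n)) ->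
  coverable d t delta eps (\bigcup_n A n).
Proof.
move=> eps0 Acov.
apply: (@coverable_bigcup _ _ _ _ _ _ _ (fun n => eps / (2 ^ n.+1)%:R)).
  by move=> n; apply: Acov; rewrite divr_gt0// ltr0n expn_gt0.
exact: (epsilon_trick0 xpredT (ltW eps0)).
Qed.

(** Borel-Cantelli: the tails of a convergent geometric series are covers of
    the limsup set, both as fine and as small as required. *)
Lemma coverable_limsup {R : realType} {T : Type} (d : T -> T -> R)
    (t C q delta eps : R) (F : (set T)^nat) (A : set T) :
  0 < t -> 0 <= C -> 0 < q < 1 -> 0 < delta -> 0 < eps ->
  (forall k, C * q ^+ k <= delta `^ t -> coverable d t delta (C * q ^+ k) (F k)) ->
  (forall x, A x -> forall N, exists2 k, (N <= k)%N & F k x) ->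
  coverable d t delta eps A.
Proof.
move=> t0 C0 /andP[q0 q1] delta0 eps0 Fcov AF.
have nq1 : `|q| < 1 by rewrite ger0_norm ?ltW.
have q1' : 0 < 1 - q by rewrite subr_gt0.
pose eta := Num.min (delta `^ t) (eps * (1 - q)).
have eta0 : 0 < eta by rewrite lt_min powR_gt0//= mulr_gt0.
have /cvgrPdist_lt /(_ _ eta0)[N _ NP] := cvg_geometric C nq1.
have Neta k : (N <= k)%N -> C * q ^+ k <= eta.
  move=> Nk; have := NP k Nk; rewrite sub0r normrN => /ltW; apply: le_trans.
  exact: ler_norm.
apply: (@coverable_sub _ _ _ _ _ _ _ (\bigcup_n F (n + N)%N)).
  move=> x /AF /(_ N)[k Nk Fk]; exists (k - N)%N => //; by rewrite subnK.
apply: (@coverable_bigcup _ _ _ _ _ _ _ (fun n => C * q ^+ (n + N))).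
  move=> n; apply: Fcov; apply: (le_trans (Neta _ (leq_addl _ _))).
  by rewrite ge_min lexx.
apply: lime_le.
  by apply: is_cvg_nneseries => n _ _; rewrite lee_fin mulr_ge0// exprn_ge0// ltW.
apply: nearW => n; rewrite sumEFin lee_fin.
have := @geometric_le_lim _ n (C * q ^+ N) q.
rewrite mulr_ge0 ?exprn_ge0 ?(ltW q0)// => /(_ isT q0 nq1) h.
apply: (@le_trans _ _ (series (geometric (C * q ^+ N) q) n)).
  rewrite /series/= le_eqVlt; apply/orP; left; apply/eqP.
  by apply: eq_bigr => i _; rewrite exprD; ring.
apply: (le_trans h); rewrite ler_pdivrMr//.
by apply: (le_trans (Neta _ (leqnn _))); rewrite ge_min lexx orbT.
Qed.

(** * Orthogonal projections and the metric of the Grassmannian *)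

Lemma dotvBr {R : realType} {n : nat} (x y z : 'rV[R]_n) :
  dotv x (y - z) = dotv x y - dotv x z.
Proof. by rewrite dotvDr -scaleN1r dotvZr mulN1r. Qed.

Lemma dotvBl {R : realType} {n : nat} (x y z : 'rV[R]_n) :
  dotv (x - y) z = dotv x z - dotv y z.
Proof. by rewrite dotvC dotvBr !(dotvC z). Qed.

Lemma dotvZl {R : realType} {n : nat} (x y : 'rV[R]_n) (a : R) :
  dotv (a *: x) y = a * dotv x y.
Proof. by rewrite dotvC dotvZr dotvC. Qed.

Lemma dotv_ge0 {R : realType} {n : nat} (x : 'rV[R]_n) : 0 <= dotv x x.
Proof. by apply: sumr_ge0 => i _; rewrite -expr2 sqr_ge0. Qed.

Lemma enorm_ge0 {R : realType} {n : nat} (x : 'rV[R]_n) : 0 <= enorm x.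
Proof. exact: sqrtr_ge0. Qed.

Lemma enorm_sqr {R : realType} {n : nat} (x : 'rV[R]_n) :
  enorm x ^+ 2 = dotv x x.
Proof. by rewrite sqr_sqrtr// dotv_ge0. Qed.

Lemma enorm0 {R : realType} {n : nat} : enorm (0 : 'rV[R]_n) = 0.
Proof. by rewrite /enorm dotv0r sqrtr0. Qed.

Lemma enorm_gt0 {R : realType} {n : nat} (x : 'rV[R]_n) : x != 0 -> 0 < enorm x.
Proof.
move=> x0; rewrite lt0r enorm_ge0 andbT; apply: contra x0 => /eqP x0.
by apply/eqP/dotv_eq0; rewrite -enorm_sqr x0 expr0n.
Qed.

Lemma enormZ {R : realType} {n : nat} (a : R) (x : 'rV[R]_n) :
  enorm (a *: x) = `|a| * enorm x.
Proof.
by rewrite /enorm dotvZl dotvZr mulrA -expr2 sqrtrM ?sqr_ge0// sqrtr_sqr.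
Qed.

Lemma enormN {R : realType} {n : nat} (x : 'rV[R]_n) : enorm (- x) = enorm x.
Proof. by rewrite -scaleN1r enormZ normrN1 mul1r. Qed.

Lemma dotv_le_enorm {R : realType} {n : nat} (x y : 'rV[R]_n) :
  dotv x y <= enorm x * enorm y.
Proof.
have [->|y0] := eqVneq y 0; first by rewrite dotv0r enorm0 mulr0.
have yy : 0 < dotv y y by rewrite -enorm_sqr exprn_gt0// enorm_gt0.
have := dotv_ge0 (dotv y y *: x - dotv x y *: y).
rewrite !(dotvBl, dotvBr, dotvZl, dotvZr) (dotvC y x) => h.
have {h} : 0 <= dotv y y * (dotv y y * dotv x x - dotv x y ^+ 2).
  by move: h; congr (_ <= _); ring.
rewrite pmulr_rge0// subr_ge0 -!enorm_sqr mulrC -exprMn => h.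
rewrite real_ler_normlW ?num_real//.
by rewrite -(ler_pXn2r (n := 2))// ?nnegrE ?mulr_ge0 ?enorm_ge0// real_normK ?num_real.
Qed.

Lemma enormD {R : realType} {n : nat} (x y : 'rV[R]_n) :
  enorm (x + y) <= enorm x + enorm y.
Proof.
rewrite -(ler_pXn2r (n := 2))// ?nnegrE ?addr_ge0 ?enorm_ge0//.
rewrite enorm_sqr sqrrD !enorm_sqr dotvDr !(dotvC (x + y)) !dotvDr (dotvC y x).
by have := dotv_le_enorm x y; lra.
Qed.

Lemma coord_le_enorm {R : realType} {n : nat} (x : 'rV[R]_n) i :
  `|x 0 i| <= enorm x.
Proof.
rewrite -(ler_pXn2r (n := 2))// ?nnegrE ?enorm_ge0// enorm_sqr real_normK ?num_real//.
rewrite /dotv (bigD1 i)//= -expr2 lerDl.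
by apply: sumr_ge0 => j _; rewrite -expr2 sqr_ge0.
Qed.

Lemma enorm_le_coord {R : realType} {n : nat} (x : 'rV[R]_n) (c : R) :
  (forall i, `|x 0 i| <= c) -> enorm x <= n%:R * c.
Proof.
move=> xc; have [n0|n0] := posnP n.
  subst n; rewrite (_ : x = 0) ?enorm0 ?mul0r//.
  by apply/rowP => -[].
have c0 : 0 <= c by exact: le_trans (xc (Ordinal n0)).
have nc0 : 0 <= n%:R * c by rewrite mulr_ge0.
rewrite -(ler_pXn2r (n := 2))// ?nnegrE ?enorm_ge0// enorm_sqr.
apply: (@le_trans _ _ (\sum_(i < n) c ^+ 2)).
  apply: ler_sum => i _; rewrite -expr2 -real_normK ?num_real//.
  by rewrite lerXn2r ?nnegrE// xc.
rewrite sumr_const card_ord -[leLHS]mulr_natl exprMn ler_wpM2r ?sqr_ge0//.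
by rewrite -natrX ler_nat -[leqLHS]expn1 leq_pexp2l.
Qed.

Lemma orthoproj_dotv {R : realType} {n : nat} (V : {vspace 'rV[R]_n})
  (x v : 'rV[R]_n) : v \in V -> dotv (orthoproj V x) v = dotv x v.
Proof.
by move=> vV; apply/esym/eqP; rewrite -subr_eq0 -dotvBl orthoproj_orth.
Qed.

Lemma enorm_le_of_sqr {R : realType} {n : nat} (x : 'rV[R]_n) (c : R) :
  dotv x x <= c * enorm x -> 0 <= c -> enorm x <= c.
Proof.
move=> h c0; have [x0|x0] := eqVneq x 0; first by rewrite x0 enorm0.
by rewrite -(ler_pM2r (enorm_gt0 x x0)) -expr2 enorm_sqr.
Qed.

Lemma enorm_orthoproj {R : realType} {n : nat} (V : {vspace 'rV[R]_n})
  (x : 'rV[R]_n) : enorm (orthoproj V x) <= enorm x.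
Proof.
apply: enorm_le_of_sqr; last exact: enorm_ge0.
by rewrite orthoproj_dotv ?orthoproj_mem// dotv_le_enorm.
Qed.

Lemma orthoproj_min {R : realType} {n : nat} (V : {vspace 'rV[R]_n})
  (x v : 'rV[R]_n) : v \in V -> enorm (x - orthoproj V x) <= enorm (x - v).
Proof.
move=> vV; apply: enorm_le_of_sqr; last exact: enorm_ge0.
apply: le_trans (dotv_le_enorm _ _).
have := @orthoproj_orth _ _ V x (v - orthoproj V x).
rewrite memvB ?orthoproj_mem// => /(_ isT) h.
rewrite (dotvC (x - v)) -[leLHS]subr0 -h -dotvBr opprB addrA.
by rewrite subrK.
Qed.

Lemma enorm_orthoproj_compl {R : realType} {n : nat} (V : {vspace 'rV[R]_n})
  (x : 'rV[R]_n) : enorm (x - orthoproj V x) <= enorm x.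
Proof. by have := orthoproj_min V x 0 (mem0v V); rewrite subr0. Qed.

Section grass_metric.
Context {R : realType} {n m : nat}.
Implicit Types U V W : grassmannian R n m.

Lemma grass_dist_le V W (c : R) :
  (forall x, enorm x <= 1 ->
     enorm (orthoproj (sval V) x - orthoproj (sval W) x) <= c) ->
  grass_dist V W <= c.
Proof.
move=> h; apply: ge_sup.
  by exists (enorm ((orthoproj (sval V) - orthoproj (sval W)) 0)), 0 => //=;
    rewrite enorm0.
by move=> _ [x /= x1 <-]; rewrite add_lfunE opp_lfunE; apply: h.
Qed.

Lemma enorm_sub_orthoproj_le2 V W (x : 'rV[R]_n) : enorm x <= 1 ->
  enorm (orthoproj (sval V) x - orthoproj (sval W) x) <= 2.
Proof.
move=> x1; apply: le_trans (enormD _ _) _; rewrite enormN.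
have := enorm_orthoproj (sval V) x; have := enorm_orthoproj (sval W) x; lra.
Qed.

Lemma le_grass_dist V W (x : 'rV[R]_n) : enorm x <= 1 ->
  enorm (orthoproj (sval V) x - orthoproj (sval W) x) <= grass_dist V W.
Proof.
move=> x1; apply: ub_le_sup.
  exists 2 => _ [y /= y1 <-]; rewrite add_lfunE opp_lfunE.
  exact: enorm_sub_orthoproj_le2.
by exists x => //; rewrite add_lfunE opp_lfunE.
Qed.

Lemma grass_dist_le2 V W : grass_dist V W <= 2.
Proof. by apply: grass_dist_le => x; exact: enorm_sub_orthoproj_le2. Qed.

Lemma grass_dist_ge0 V W : 0 <= grass_dist V W.
Proof. by apply: le_trans (le_grass_dist V W 0 _); rewrite ?enorm0 ?enorm_ge0. Qed.

Lemma grass_distxx V : grass_dist V V = 0.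
Proof.
apply/eqP; rewrite eq_le grass_dist_ge0 andbT.
by apply: grass_dist_le => x _; rewrite subrr enorm0.
Qed.

Lemma grass_distC V W : grass_dist V W = grass_dist W V.
Proof.
apply/eqP; rewrite eq_le; apply/andP; split; apply: grass_dist_le => x x1;
  by rewrite -enormN opprB le_grass_dist.
Qed.

Lemma grass_dist_triangle U V W :
  grass_dist U W <= grass_dist U V + grass_dist V W.
Proof.
apply: grass_dist_le => x x1.
rewrite -(subrKA (orthoproj (sval V) x)); apply: le_trans (enormD _ _) _.
by rewrite lerD ?le_grass_dist.
Qed.

End grass_metric.

(** * Graph charts of the Grassmannian *)

(** V is the graph, over the coordinate axes in the image of f, of a linear map
    with entries of absolute value at most 1.  The m x n matrix A contains
    identity columns at the indices f k; keeping them spares a splitting of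
    the index set. *)
Definition chart {R : realType} {n m : nat} (V : grassmannian R n m)
    (f : 'I_m -> 'I_n) (A : 'M[R]_(m, n)) : Prop :=
  [/\ forall i k, A i (f k) = (i == k)%:R, forall i j, `|A i j| <= 1,
      forall i, row i A \in sval V &
      forall v, v \in sval V -> v = (\row_k v 0 (f k)) *m A].

Lemma det_id_replace_col {R : comNzRingType} {m : nat} (Q : 'M[R]_m) (i : 'I_m) :
  (forall l k, k != i -> Q l k = (l == k)%:R) -> \det Q = Q i i.
Proof.
move=> Qid; rewrite (expand_det_row _ i) (bigD1 i)//= big1 ?addr0; last first.
  by move=> k ki; rewrite Qid// eq_sym (negbTE ki) mul0r.
rewrite /cofactor (_ : row' i (col' i Q) = 1%:M) ?det1.
  by rewrite addnn -signr_odd odd_double expr0 !mulr1.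
by apply/matrixP => a b; rewrite !mxE Qid ?(inj_eq lift_inj)// eq_sym neq_lift.
Qed.

(** Choose the columns f of a basis matrix M that maximize the absolute value of
    the minor, and A = M_f^-1 M.  By Cramer's rule each entry of A is a
    quotient of two minors of M, the denominator being the maximal one. *)
Lemma exists_chart {R : realType} {n m : nat} (V : grassmannian R n m) :
  exists f A, chart V f A.
Proof.
have /eqP dimV : \dim (sval V) == m by exact: (svalP V).
pose M : 'M[R]_(m, n) := \matrix_(i < m) (vbasis (sval V))`_i.
have rowM i : row i M \in sval V.
  rewrite rowK; apply/vbasis_mem/mem_nth; rewrite size_tuple dimV.
  exact: ltn_ord.
have spanM v : v \in sval V -> exists u, v = u *m M.
  move=> vV.
  exists (\row_(i < m) coord (vbasis (sval V)) (cast_ord (esym dimV) i) v).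
  rewrite [LHS](coord_vbasis vV) mulmx_sum_row.
  rewrite (reindex (cast_ord (esym dimV))) /=; last first.
    by exists (cast_ord dimV) => i _; rewrite ?cast_ordK ?cast_ordKV.
  by apply: eq_bigr => i _; rewrite mxE rowK.
have freeM : row_free M.
  apply: inj_row_free => u uM.
  have /freeP fr := basis_free (vbasisP (sval V)).
  apply/rowP => i; rewrite mxE.
  have := fr (fun j => u 0 (cast_ord dimV j)) _ (cast_ord (esym dimV) i).
  rewrite cast_ordKV; apply.
  rewrite -[RHS]uM mulmx_sum_row.
  rewrite [RHS](reindex (cast_ord dimV)) /=; last first.
    by exists (cast_ord (esym dimV)) => j _; rewrite ?cast_ordK ?cast_ordKV.
  by apply: eq_bigr => j _; rewrite rowK.
pose minor (f : {ffun 'I_m -> 'I_n}) := \det (colsub f M).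
have [f0 f0P] : exists f0, minor f0 != 0.
  have fullM : row_full M^T by rewrite -col_leq_rank mxrank_tr; rewrite -row_leq_rank in freeM.
  exists (fullrankfun fullM); rewrite -unitfE -unitmxE -unitmx_tr trmx_mxsub.
  exact: fullrowsub_unit.
case: (arg_maxP (P := predT) (fun f => `|minor f|) (i0 := f0) isT) => f _ fmax.
have minf : minor f != 0.
  by rewrite -normr_gt0 (lt_le_trans _ (fmax f0 isT))// normr_gt0.
have unitf : colsub f M \in unitmx by rewrite unitmxE unitfE.
pose A := invmx (colsub f M) *m M.
have Af : colsub f A = 1%:M by rewrite /A -mulmx_colsub mulVmx.
have MA : M = colsub f M *m A by rewrite mulKVmx.
have Afk i k : A i (f k) = (i == k)%:R.
  by have /matrixP/(_ i k) := Af; rewrite !mxE.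
exists f, A; split => //.
- move=> i j.
  pose g := [ffun k => if k == i then j else f k].
  have : minor g = minor f * \det (colsub g A).
    by rewrite /minor -det_mulmx mulmx_colsub -MA.
  rewrite (@det_id_replace_col _ _ _ i); last first.
    by move=> l k ki; rewrite mxE ffunE (negbTE ki) Afk.
  rewrite mxE ffunE eqxx => mg.
  have /= := fmax g isT; rewrite mg normrM ger_pMr// normr_gt0//.
- move=> i; rewrite /A row_mul mulmx_sum_row; apply: memv_suml => k _.
  exact/memvZ/rowM.
- move=> v /spanM[u ->].
  have -> : \row_k (u *m M) 0 (f k) = colsub f (u *m M).
    by apply/rowP => k; rewrite !mxE.
  by rewrite -mulmx_colsub -mulmxA -MA.
Qed.

(** With P, Q the projections to V, W, write P - Q = (1 - Q) P - Q (1 - P).  The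
    first term is controlled by the distance from V to W, the second is the
    adjoint of (1 - P) Q, hence is controlled by the distance from W to V. *)
Lemma grass_dist_gap {R : realType} {n m : nat} (V W : grassmannian R n m)
    (c : R) : 0 <= c ->
  (forall v, v \in sval V -> enorm (v - orthoproj (sval W) v) <= c * enorm v) ->
  (forall w, w \in sval W -> enorm (w - orthoproj (sval V) w) <= c * enorm w) ->
  grass_dist V W <= 2 * c.
Proof.
move=> c0 VW WV; apply: grass_dist_le => x x1.
pose z := orthoproj (sval W) (x - orthoproj (sval V) x).
have -> : orthoproj (sval V) x - orthoproj (sval W) x =
    (orthoproj (sval V) x - orthoproj (sval W) (orthoproj (sval V) x)) - z.
  by rewrite /z linearB/= opprB addrA subrK.
apply: le_trans (enormD _ _) _; rewrite enormN mulr_natl mulr2n lerD//.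
  apply: le_trans (VW _ (orthoproj_mem _ _)) _.
  by rewrite ler_piMr// (le_trans (enorm_orthoproj _ _)).
have zW : z \in sval W by exact: orthoproj_mem.
apply: enorm_le_of_sqr => //.
have -> : dotv z z = dotv (z - orthoproj (sval V) z) (x - orthoproj (sval V) x).
  rewrite {1}/z orthoproj_dotv// [RHS]dotvBl [X in _ = _ - X]dotvC.
  by rewrite (orthoproj_orth _ (orthoproj_mem (sval V) z)) subr0 dotvC.
apply: le_trans (dotv_le_enorm _ _) _.
rewrite -[leRHS]mulr1 ler_pM ?enorm_ge0// ?WV//.
by rewrite (le_trans (enorm_orthoproj_compl _ _)).
Qed.

(** The vector v = u A of V is compared with u B in W; the coordinates u of v
    are bounded by |v|, being among those of v. *)
Lemma chart_gap {R : realType} {n m : nat} (V W : grassmannian R n m)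
    f (A B : 'M[R]_(m, n)) (eta : R) v :
  chart V f A -> chart W f B -> (forall i j, `|A i j - B i j| <= eta) ->
  v \in sval V ->
  enorm (v - orthoproj (sval W) v) <= n%:R * m%:R * eta * enorm v.
Proof.
move=> [_ _ _ VA] [_ _ WB _] AB vV.
pose u := \row_k v 0 (f k).
apply: (@le_trans _ _ (enorm (v - u *m B))).
  apply: orthoproj_min; rewrite mulmx_sum_row.
  by apply: memv_suml => k _; apply: memvZ.
rewrite {1}(VA _ vV) -/u -mulmxBr -!mulrA; apply: enorm_le_coord => j.
rewrite mxE; apply: le_trans (ler_norm_sum _ _ _) _.
apply: (@le_trans _ _ (\sum_(k < m) enorm v * eta)).
  apply: ler_sum => k _; rewrite !mxE normrM ler_pM//.
  exact: coord_le_enorm.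
by rewrite sumr_const card_ord mulr_natl (mulrC eta).
Qed.

Lemma chart_dist {R : realType} {n m : nat} (V W : grassmannian R n m)
    f (A B : 'M[R]_(m, n)) (eta : R) : 0 <= eta ->
  chart V f A -> chart W f B -> (forall i j, `|A i j - B i j| <= eta) ->
  grass_dist V W <= 2 * (n%:R * m%:R * eta).
Proof.
move=> eta0 VA WB AB; apply: grass_dist_gap.
- by rewrite !mulr_ge0.
- by move=> v; apply: chart_gap VA WB AB.
- by move=> v; apply: (chart_gap _ _ _ _ _ _ _ WB VA) => i j; rewrite distrC.
Qed.

Definition grid {R : realType} (delta a : R) : nat := Num.truncn ((a + 1) / delta).

Lemma grid_le {R : realType} (delta a : R) : 0 < delta -> `|a| <= 1 ->
  (grid delta a <= Num.truncn (2 / delta))%N.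
Proof.
move=> d0; rewrite ler_norml => /andP[a1 a2]; apply: le_truncn.
by rewrite ler_pM2r ?invr_gt0//; lra.
Qed.

Lemma grid_dist {R : realType} (delta a b : R) : 0 < delta ->
  `|a| <= 1 -> `|b| <= 1 -> grid delta a = grid delta b -> `|a - b| <= delta.
Proof.
move=> d0; rewrite !ler_norml => /andP[a1 a2] /andP[b1 b2] ab.
have ga : 0 <= (a + 1) / delta by rewrite divr_ge0 ?(ltW d0)//; lra.
have gb : 0 <= (b + 1) / delta by rewrite divr_ge0 ?(ltW d0)//; lra.
have /andP[al ah] := truncn_itv ga.
have /andP[bl bh] := truncn_itv gb.
move: bl bh; rewrite -/(grid delta b) -ab => bl bh.
rewrite -/(grid delta a) in al ah.
move: al ah bl bh; rewrite -natr1 !ler_pdivlMr// !ltr_pdivrMr//.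
rewrite mulrDl mul1r; set g := _ * delta => al ah bl bh.
by apply/andP; split; lra.
Qed.

(** * Coverings of the Grassmannian and of slabs *)

(** Total boundedness, in the form of a finite colouring with small classes. *)
Lemma grass_net {R : realType} {n m : nat} (delta : R) : 0 < delta ->
  exists (K : finType) (key : grassmannian R n m -> K),
    forall V W, key V = key W -> grass_dist V W <= delta.
Proof.
move=> d0; pose eta : R := delta / (2 * (n%:R * m%:R) + 1).
(* The summand 1 keeps the quotient meaningful when n or m is 0. *)
have D0 : 0 < 2 * (n%:R * m%:R) + 1 :> R by rewrite ltr_wpDl// !mulr_ge0.
have eta0 : 0 < eta by rewrite divr_gt0.
have [F FP] : {F : grassmannian R n m -> {ffun 'I_m -> 'I_n} * 'M[R]_(m, n) &
    forall V, chart V (F V).1 (F V).2}.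
  apply: (@choice _ _ (fun V (F : {ffun 'I_m -> 'I_n} * 'M[R]_(m, n)) =>
    chart V F.1 F.2)) => V.
  have [f [A [A1 A2 A3 A4]]] := exists_chart V.
  exists (finfun f, A); split => //=.
    by move=> i k; rewrite ffunE.
  by move=> v /A4 {1}->; congr (_ *m _); apply/rowP => k; rewrite !mxE ffunE.
pose N := Num.truncn (2 / eta).
pose key V : {ffun 'I_m -> 'I_n} * {ffun 'I_m * 'I_n -> 'I_N.+1} :=
  ((F V).1, [ffun p => inord (grid eta ((F V).2 p.1 p.2))]).
exists _, key => V W [fVW /ffunP gVW].
have WP := FP W; rewrite -fVW in WP.
have [_ AV _ _] := FP V; have [_ AW _ _] := FP W.
apply: le_trans (chart_dist _ _ _ _ _ _ (ltW eta0) (FP V) WP _) _.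
  move=> i j; apply: grid_dist => //.
  have := congr1 val (gVW (i, j)); rewrite !ffunE /= !inordK ?ltnS ?grid_le//.
rewrite /eta mulrA mulrCA -[leRHS]mulr1 ler_wpM2l ?(ltW d0)//.
by rewrite ler_pdivrMr// mul1r lerDl.
Qed.

Section slab.
Context {R : realType} {n m : nat} (x : 'rV[R]_n) (delta : R).
Hypothesis x1 : enorm x = 1.
Implicit Types (V W : grassmannian R n m) (A B : 'M[R]_(m, n)).

(** A row of A is a vector of V, so its inner product with x only sees the
    projection of x. *)
Lemma chart_row_slab V f A i : chart V f A ->
  enorm (orthoproj (sval V) x) <= delta ->
  `|\sum_j A i j * x 0 j| <= n%:R * delta.
Proof.
move=> [_ A1 AV _] Vx.
have -> : \sum_j A i j * x 0 j = dotv (orthoproj (sval V) x) (row i A).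
  by rewrite orthoproj_dotv// dotvC; apply: eq_bigr => j _; rewrite !mxE.
have rowA : enorm (row i A) <= n%:R.
  by rewrite -[leRHS]mulr1; apply: enorm_le_coord => j; rewrite mxE.
have le1 (y : 'rV[R]_n) : enorm y <= delta ->
    dotv y (row i A) <= n%:R * delta.
  move=> yd; apply: le_trans (dotv_le_enorm _ _) _.
  by rewrite mulrC ler_pM ?enorm_ge0.
rewrite ler_norml le1// andbT lerNl.
have -> : - dotv (orthoproj (sval V) x) (row i A) =
    dotv (- orthoproj (sval V) x) (row i A) by rewrite -[in RHS]scaleN1r dotvZl mulN1r.
by rewrite le1// enormN.
Qed.

(** By [chart_row_slab], the coordinates of x along the axes of the chart are
    bounded by n delta plus n times the largest of the others; as x is a unit
    vector, the latter cannot be small. *)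
Lemma free_coord_large V f A j : chart V f A ->
  enorm (orthoproj (sval V) x) <= delta ->
  (forall j', j' \notin codom f -> `|x 0 j'| <= `|x 0 j|) ->
  1 <= n%:R * (n%:R * delta + n%:R * `|x 0 j|).
Proof.
move=> VA Vx jmax; rewrite -{1}x1.
have d0 : 0 <= delta by exact: le_trans (enorm_ge0 _) Vx.
apply: enorm_le_coord => j'.
have n1 : 1 <= n%:R :> R.
  by rewrite ler1n; case: (n) j' => [[]|].
have [/codomP[k ->]|j'f] := boolP (j' \in codom f); last first.
  apply: le_trans (jmax _ j'f) _; apply: le_trans (_ : _ <= n%:R * `|x 0 j|) _.
    by rewrite ler_peMl.
  by rewrite lerDr mulr_ge0.
have [Afk A1 _ _] := VA.
have -> : x 0 (f k) = \sum_j A k j * x 0 j - \sum_(j | j != f k) A k j * x 0 j.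
  by rewrite [X in X - _](bigD1 (f k))//= addrK Afk eqxx mul1r.
apply: le_trans (ler_normB _ _) _; rewrite lerD ?(chart_row_slab V f)//.
apply: le_trans (ler_norm_sum _ _ _) _.
apply: (@le_trans _ _ (\sum_(j' < n) `|x 0 j|)); last first.
  by rewrite sumr_const card_ord mulr_natl.
rewrite [leRHS](bigID (fun j => j != f k))/= ler_wpDr ?sumr_ge0//.
apply: ler_sum => l lk; rewrite normrM.
have [/codomP[k' lk']|lf] := boolP (l \in codom f).
  rewrite lk' Afk; case: eqP => [kk'|]; last by rewrite normr0 mul0r.
  by rewrite lk' kk' eqxx in lk.
by rewrite -[leRHS]mul1r ler_pM// jmax.
Qed.

(** Two charts that agree up to delta except in the column j agree up to
    O(delta) in that column also: [chart_row_slab] bounds the sum over all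
    columns of (A i l - B i l) x_l, and the coefficient x_j is bounded below. *)
Lemma slab_entries V W f A B j : 2 * (n%:R ^+ 2 * delta) <= 1 ->
  chart V f A -> chart W f B ->
  enorm (orthoproj (sval V) x) <= delta ->
  enorm (orthoproj (sval W) x) <= delta ->
  (forall j', j' \notin codom f -> `|x 0 j'| <= `|x 0 j|) ->
  (forall i j', j' \notin codom f -> j' != j -> `|A i j' - B i j'| <= delta) ->
  forall i j', `|A i j' - B i j'| <= 6 * n%:R ^+ 3 * delta.
Proof.
move=> dsmall VA WB Vx Wx jmax AB i j'.
have d0 : 0 <= delta by exact: le_trans (enorm_ge0 _) Vx.
have n1 : 1 <= n%:R :> R.
  by rewrite ler1n; case: (n) j' => [[]|].
have dle : delta <= 6 * n%:R ^+ 3 * delta.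
  rewrite ler_peMl// -[leLHS]mulr1 ler_pM// ?ler1n//.
  by rewrite exprn_ege1.
have ABd l : l != j -> `|A i l - B i l| <= delta.
  move=> lj; have [/codomP[k ->]|lf] := boolP (l \in codom f); last exact: AB.
  by have [-> _ _ _] := VA; have [-> _ _ _] := WB; rewrite subrr normr0.
have [->|j'j] := eqVneq j' j; last by apply: le_trans dle; exact: ABd.
have large := free_coord_large _ _ _ _ VA Vx jmax.
have AB3 : `|A i j - B i j| * `|x 0 j| <= 3 * n%:R * delta.
  rewrite -normrM.
  have -> : (A i j - B i j) * x 0 j = \sum_l A i l * x 0 l - \sum_l B i l * x 0 l
      - \sum_(l | l != j) (A i l - B i l) * x 0 l.
    rewrite -sumrB; under eq_bigr do rewrite -mulrBl.
    by rewrite (bigD1 j)//= addrK.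
  have -> : 3 * n%:R * delta = n%:R * delta + n%:R * delta + n%:R * delta by ring.
  apply: le_trans (ler_normB _ _) _; rewrite lerD//.
    by apply: le_trans (ler_normB _ _) _; rewrite lerD//;
      [exact: chart_row_slab VA Vx|exact: chart_row_slab WB Wx].
  apply: le_trans (ler_norm_sum _ _ _) _.
  apply: (@le_trans _ _ (\sum_(l < n) delta)); last first.
    by rewrite sumr_const card_ord mulr_natl.
  rewrite [leRHS](bigID (fun l => l != j))/= ler_wpDr ?sumr_ge0//.
  apply: ler_sum => l lj; rewrite normrM -[leRHS]mulr1 ler_pM ?ABd//.
  by rewrite -x1 coord_le_enorm.
have {}large : 1 <= 2 * n%:R ^+ 2 * `|x 0 j| by lra.
apply: (@le_trans _ _ (`|A i j - B i j| * (2 * n%:R ^+ 2 * `|x 0 j|))).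
  by rewrite ler_peMr.
have -> : 6 * n%:R ^+ 3 * delta = (2 * n%:R ^+ 2) * (3 * n%:R * delta) by ring.
by rewrite mulrCA ler_wpM2l// mulr_ge0// exprn_ge0.
Qed.

End slab.

Lemma chart_inj {R : realType} {n m : nat} (V : grassmannian R n m) f A :
  chart V f A -> injective f.
Proof.
move=> [Afk _ _ _] k l fkl; have := Afk k l; rewrite -fkl Afk eqxx.
by case: eqP => // _ /eqP; rewrite oner_eq0.
Qed.

(** The entries of A that are neither identity entries nor in the column j that
    the slab condition determines. *)
Definition free_entries {n m : nat} (f : 'I_m -> 'I_n) (j : 'I_n) :
    {pred 'I_m * 'I_n} :=
  [predX predT & [predC (j :: codom f)]].

Lemma card_free_entries {n m : nat} (f : 'I_m -> 'I_n) (j : 'I_n) :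
  injective f -> j \notin codom f ->
  #|free_entries f j| = (m * (n - m - 1))%N.
Proof.
move=> finj jf; rewrite cardX card_ord; congr (_ * _)%N.
have := cardC (mem (j :: codom f)); rewrite card_ord.
have /card_uniqP -> : uniq (j :: codom f).
  by rewrite /= jf; apply/injectiveP.
rewrite /= size_codom card_ord => nE.
have mn : (m.+1 <= n)%N by rewrite -[leqRHS]nE leq_addr.
by apply/eqP; rewrite -(eqn_add2l m.+1); apply/eqP; transitivity n => //; lia.
Qed.

Lemma chart_pivot {R : realType} {n m : nat} (x : 'rV[R]_n)
    (V : grassmannian R n m) f A : (m < n)%N -> chart V f A ->
  exists2 j, j \notin codom f &
    forall j', j' \notin codom f -> `|x 0 j'| <= `|x 0 j|.
Proof.
move=> mn VA; have [j0 j0f] : exists j, j \notin codom f.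
  apply/existsP; rewrite -negb_forall; apply/negP => /forallP fsurj.
  have : (#|'I_n| <= #|codom f|)%N by apply/subset_leq_card/fintype.subsetP.
  by rewrite (card_codom (chart_inj _ _ _ VA)) !card_ord leqNgt mn.
case: (arg_maxP (P := fun j => j \notin codom f) (fun j => `|x 0 j|) j0f) => j.
by exists j.
Qed.

(** The class of V records the axes of its chart, the column j where |x_j| is
    largest, and the cells of the m(n-m-1) free entries. *)
Lemma slab_key_unit {R : realType} {n m : nat} (x : 'rV[R]_n) (delta : R) :
  (m < n)%N -> 0 < delta -> 2 * (n%:R ^+ 2 * delta) <= 1 -> enorm x = 1 ->
  exists (K : finType) (key : grassmannian R n m -> K),
    #|K|%:R <= (n ^ m * n)%:R * (3 / delta) ^+ (m * (n - m - 1)) /\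
    forall V W, enorm (orthoproj (sval V) x) <= delta ->
      enorm (orthoproj (sval W) x) <= delta ->
      key V = key W -> grass_dist V W <= 12 * n%:R ^+ 5 * delta.
Proof.
move=> mn d0 dsmall x1.
have n1 : 1 <= n%:R :> R by rewrite ler1n (leq_ltn_trans (leq0n m) mn).
have [F FP] : {F : grassmannian R n m -> {ffun 'I_m -> 'I_n} * 'M[R]_(m, n) * 'I_n &
    forall V, [/\ chart V (F V).1.1 (F V).1.2, (F V).2 \notin codom (F V).1.1 &
    forall j', j' \notin codom (F V).1.1 -> `|x 0 j'| <= `|x 0 (F V).2|]}.
  apply: (@choice _ _ (fun V (F : {ffun 'I_m -> 'I_n} * 'M[R]_(m, n) * 'I_n) =>
    [/\ chart V F.1.1 F.1.2, F.2 \notin codom F.1.1 &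
    forall j', j' \notin codom F.1.1 -> `|x 0 j'| <= `|x 0 F.2|])) => V.
  have [f [A [A1 A2 A3 A4]]] := exists_chart V.
  have VA : chart V (finfun f) A.
    split => //=; first by move=> i k; rewrite ffunE.
    by move=> v /A4 {1}->; congr (_ *m _); apply/rowP => k; rewrite !mxE ffunE.
  by have [j jf jmax] := chart_pivot x _ _ _ mn VA; exists (finfun f, A, j).
pose N := Num.truncn (2 / delta).
pose M := (m * (n - m - 1))%N.
pose free V := enum (free_entries (F V).1.1 (F V).2).
pose gr V p : 'I_N.+1 := inord (grid delta ((F V).1.2 p.1 p.2)).
pose key V : {ffun 'I_m -> 'I_n} * 'I_n * {ffun 'I_M -> 'I_N.+1} :=
  ((F V).1.1, (F V).2, [ffun e : 'I_M =>
     if onth (free V) e is Some p then gr V p else ord0]).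
exists _, key; split.
  rewrite !card_prod !card_ffun !card_ord !natrM ler_wpM2l//.
  rewrite natrX lerXn2r ?nnegrE ?divr_ge0 ?(ltW d0)// -natr1.
  have : N%:R <= 2 / delta by rewrite truncn_le divr_ge0// ltW.
  have : 1 <= delta^-1.
    rewrite invf_ge1//; apply: le_trans dsmall.
    have := exprn_ege1 2 n1; nra.
  lra.
move=> V W Vx Wx [fVW jVW /ffunP gVW].
have [VA jV jVmax] := FP V; have [WA jW jWmax] := FP W.
rewrite -fVW -jVW in WA jW jWmax.
have cAB i j' : `|(F V).1.2 i j' - (F W).1.2 i j'| <= 6 * n%:R ^+ 3 * delta.
  apply: (slab_entries x delta x1 _ _ _ _ _ _ dsmall VA WA Vx Wx jVmax).
  move=> {}i {}j' j'f j'j.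
  have [_ AV _ _] := VA; have [_ AW _ _] := WA.
  have ijD : (i, j') \in free V.
    by rewrite mem_enum !inE /= negb_or j'j.
  have eM : (index (i, j') (free V) < M)%N.
    rewrite /M -(card_free_entries _ _ (chart_inj _ _ _ VA) jV).
    by rewrite cardE index_mem.
  have := congr1 val (gVW (Ordinal eM)); rewrite !ffunE /=.
  have -> : free W = free V by rewrite /free fVW jVW.
  have -> : onth (free V) (index (i, j') (free V)) = Some (i, j').
    by rewrite onthE (nth_map (i, j')) ?nth_index// index_mem.
  rewrite /gr /= !inordK ?ltnS ?grid_le// => gg.
  exact: grid_dist.
apply: le_trans (chart_dist _ _ _ _ _ _ _ VA WA cAB) _.
  by rewrite !mulr_ge0 ?exprn_ge0 ?(ltW d0).
have mn' : m%:R <= n%:R :> R by rewrite ler_nat ltnW.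
have : 0 <= n%:R ^+ 4 * delta by rewrite mulr_ge0 ?exprn_ge0 ?(ltW d0).
have -> : 2 * (n%:R * m%:R * (6 * n%:R ^+ 3 * delta)) =
  12 * m%:R * (n%:R ^+ 4 * delta) by ring.
have -> : 12 * n%:R ^+ 5 * delta = 12 * n%:R * (n%:R ^+ 4 * delta) by ring.
by move=> h; rewrite ler_wpM2r// ler_wpM2l.
Qed.

(** The submanifold of the m-planes orthogonal to x has dimension m(n-m-1).  For
    delta bounded below a single class is enough, since all distances are at
    most 2. *)
Lemma slab_key {R : realType} (n m : nat) : (m < n)%N ->
  exists2 C : R, 0 < C & forall (x : 'rV[R]_n) (delta : R),
    0 < delta <= 1 -> x != 0 ->
  exists (K : finType) (key : grassmannian R n m -> K),
    #|K|%:R <= C * (delta^-1) ^+ (m * (n - m - 1)) /\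
    forall V W, enorm (orthoproj (sval V) x) <= delta * enorm x ->
      enorm (orthoproj (sval W) x) <= delta * enorm x ->
      key V = key W -> grass_dist V W <= C * delta.
Proof.
move=> mn; have n1 : 1 <= n%:R :> R by rewrite ler1n (leq_ltn_trans (leq0n m) mn).
set M := (m * (n - m - 1))%N.
pose C : R := (n ^ m * n)%:R * 3 ^+ M + 12 * n%:R ^+ 5 + 4 * n%:R ^+ 2 + 1.
have C1 : 0 <= (n ^ m * n)%:R * 3 ^+ M :> R by rewrite mulr_ge0 ?exprn_ge0.
have C2 : 0 <= 12 * n%:R ^+ 5 :> R by rewrite mulr_ge0 ?exprn_ge0.
have C3 : 0 <= 4 * n%:R ^+ 2 :> R by rewrite mulr_ge0 ?exprn_ge0.
exists C => [|x delta /andP[d0 d1] x0]; first by rewrite /C; lra.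
have [dsmall|dbig] := leP (2 * (n%:R ^+ 2 * delta)) 1; last first.
  exists unit, (fun=> tt); split => [|V W _ _ _].
    rewrite card_unit; have := @exprn_ege1 R M delta^-1.
    rewrite invf_ge1// => /(_ d1) h; apply: le_trans h _.
    by rewrite ler_peMl ?exprn_ge0 ?invr_ge0 ?(ltW d0)// /C; lra.
  apply: le_trans (grass_dist_le2 V W) _.
  have : 4 * n%:R ^+ 2 * delta <= C * delta by rewrite ler_pM2r// /C; lra.
  lra.
pose y := (enorm x)^-1 *: x.
have nx : 0 < enorm x by exact: enorm_gt0.
have y1 : enorm y = 1 by rewrite enormZ gtr0_norm ?invr_gt0// mulVf ?gt_eqF.
have [K [key [Kc keyP]]] := slab_key_unit y delta mn d0 dsmall y1.
exists K, key; split.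
  apply: le_trans Kc _; rewrite exprMn mulrA ler_wpM2r ?exprn_ge0 ?invr_ge0 ?(ltW d0)//.
  by rewrite /C; lra.
have toy (V : grassmannian R n m) : enorm (orthoproj (sval V) x) <= delta * enorm x ->
    enorm (orthoproj (sval V) y) <= delta.
  move=> h; rewrite /y linearZ enormZ gtr0_norm ?invr_gt0// mulrC.
  by rewrite ler_pdivrMr.
move=> V W Vx Wx VW; have h := keyP V W (toy V Vx) (toy W Wx) VW.
apply: (le_trans h); by rewrite ler_pM2r// /C; lra.
Qed.

(** * Regular weights of slabs *)

Lemma phi_le1_of_small {R : realType} {n : nat} (r s : R) (x : 'rV[R]_n) :
  0 < r -> 0 <= s -> enorm x <= r -> phi r s x = 1.
Proof.
move=> r0 s0 xr; rewrite /phi; case: eqVneq => // x0.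
apply/min_idPl; have <- : 1 `^ s = 1 :> R by rewrite powR1.
rewrite ge0_ler_powR// ?nnegrE//.
  by rewrite divr_ge0 ?enorm_ge0 ?ltW.
by rewrite ler_pdivlMr ?enorm_gt0// mul1r.
Qed.

Lemma phi_large {R : realType} {n : nat} (r s : R) (x : 'rV[R]_n) :
  0 < r -> 0 <= s -> r < enorm x -> phi r s x = (r / enorm x) `^ s.
Proof.
move=> r0 s0 xr; have nx : 0 < enorm x by exact: lt_trans xr.
rewrite /phi; case: eqVneq => [x0|x0]; first by rewrite x0 enorm0 ltxx in nx.
apply/min_idPr; have <- : 1 `^ s = 1 :> R by rewrite powR1.
rewrite ge0_ler_powR// ?nnegrE//.
  by rewrite divr_ge0 ?enorm_ge0 ?ltW.
by rewrite ler_pdivrMr// mul1r ltW.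
Qed.

(** The Frostman condition with exponent t, at scales at least r. *)
Definition regular_weights {R : realType} {n m : nat} (t r : R) (I : finType)
    (p : I -> grassmannian R n m) (w : I -> R) : Prop :=
  (forall i, 0 <= w i) /\
  forall q rho, r <= rho -> \sum_(i | grass_dist (p q) (p i) <= rho) w i <= rho `^ t.

(** With delta = r/|x| < 1, the slab consists of O(delta^(-m(n-m-1))) classes of
    weight O(delta^t), and t - m(n-m-1) >= s.  The bound D on |x| makes the
    scale O(delta) of the classes at least r, where the weights are
    controlled. *)
Lemma slab_weight {R : realType} (n m : nat) (s t D : R) :
  (m < n)%N -> 0 <= s -> (m * (n - m - 1))%:R + s <= t -> 0 < D ->
  exists2 C : R, 0 < C & forall (r : R) (I : finType)
      (p : I -> grassmannian R n m) (w : I -> R),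
    0 < r <= 1 -> regular_weights t r I p w ->
    forall x : 'rV[R]_n, enorm x <= D ->
    \sum_(i | enorm (orthoproj (sval (p i)) x) <= r) w i <= C * phi r s x.
Proof.
move=> mn s0 st D0; have [C0 C00 slabP] := @slab_key R n m mn.
set M := (m * (n - m - 1))%N in st slabP.
have t0 : 0 <= t by rewrite (le_trans _ st)// addr_ge0.
exists (2 `^ t + C0 * (C0 + D) `^ t).
  by rewrite ltr_wpDr ?mulr_ge0 ?powR_ge0 ?(ltW C00)// powR_gt0.
move=> r I p w /andP[r0 r1] [w0 wreg] x xD.
have [xr|rx] := leP (enorm x) r.
  rewrite phi_le1_of_small// mulr1.
  have [q _|I0] := pickP I; last first.
    by rewrite big1 ?addr_ge0 ?mulr_ge0 ?powR_ge0 ?(ltW C00)// => i; have := I0 i.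
  apply: (@le_trans _ _ (2 `^ t)); last first.
    by rewrite lerDl mulr_ge0 ?powR_ge0 ?(ltW C00).
  apply: le_trans (wreg q 2 _); last by rewrite (le_trans r1)// ler1n.
  rewrite big_mkcond [leRHS]big_mkcond; apply: ler_sum => i _.
  by rewrite grass_dist_le2; case: ifP.
rewrite phi_large//.
have nx : 0 < enorm x by exact: lt_trans rx.
have x0 : x != 0 by apply: contraTneq nx => ->; rewrite enorm0 ltxx.
set delta := r / enorm x.
have d0 : 0 < delta by rewrite divr_gt0.
have d1 : delta <= 1 by rewrite ler_pdivrMr// mul1r ltW.
have rE : r = delta * enorm x by rewrite divfK// gt_eqF.
have [|K [key [Kc keyP]]] := slabP x delta _ x0; first by rewrite d0.
pose rho := (C0 + D) * delta.
have CD0 : 0 < C0 + D by rewrite addr_gt0.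
have rrho : r <= rho.
  apply: (@le_trans _ _ (D * delta)); last by rewrite ler_pM2r// lerDr ltW.
  by rewrite {1}rE mulrC ler_pM2r.
rewrite (partition_big (fun i => key (p i)) predT)//=.
apply: (@le_trans _ _ (\sum_(k : K) rho `^ t)).
  apply: ler_sum => k _.
  have [q /andP[qx /eqP qk]|none] := pickP (fun i =>
    (enorm (orthoproj (sval (p i)) x) <= r) && (key (p i) == k)); last first.
    by rewrite big_pred0// powR_ge0.
  apply: le_trans (wreg q rho rrho).
  rewrite big_mkcond [leRHS]big_mkcond; apply: ler_sum => i _.
  case: ifP => [/andP[ix /eqP ik]|_]; last by case: ifP.
  rewrite ifT//; apply: (@le_trans _ _ (C0 * delta)).
    by apply: keyP; rewrite -?rE// qk ik.
  by rewrite /rho ler_pM2r// lerDl ltW.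
rewrite sumr_const -[leLHS]mulr_natl.
apply: (@le_trans _ _ (C0 * (delta^-1) ^+ M * rho `^ t)).
  by rewrite ler_wpM2r ?powR_ge0.
rewrite /rho powRM ?(ltW CD0) ?(ltW d0)//.
have dM : delta^-1 ^+ M * delta `^ t <= delta `^ s.
  rewrite -[X in X * _](powR_mulrn M) ?invr_ge0 ?(ltW d0)//.
  rewrite -powR_inv1 ?(ltW d0)// -powRrM mulN1r -powRD ?(gt_eqF d0) ?implybT//.
  by rewrite ger_powR ?d0//; lra.
rewrite [leLHS](_ : _ = C0 * (C0 + D) `^ t * (delta^-1 ^+ M * delta `^ t)); last first.
  by rewrite -!mulrA; congr (_ * _); rewrite mulrCA.
apply: (@le_trans _ _ (C0 * (C0 + D) `^ t * delta `^ s)).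
  by rewrite ler_wpM2l// mulr_ge0 ?powR_ge0// ltW.
by rewrite ler_wpM2r ?powR_ge0// lerDr powR_ge0.
Qed.

(** * Slabs and measures on a compact set *)

Lemma enorm_lin_continuous {R : realType} {n : nat} (f : 'End('rV[R]_n))
    (y : 'rV[R]_n) : continuous (fun x : 'rV[R]_n => enorm (f (x - y))).
Proof.
have coordE x i : (f (x - y)) 0 i = \sum_j (x 0 j - y 0 j) * (lin1_mx f) j i.
  by rewrite -(mul_rV_lin1 f) mxE; apply: eq_bigr => j _; rewrite !mxE.
have coordC i : continuous (fun x : 'rV[R]_n => (f (x - y)) 0 i).
  rewrite (_ : (fun x => _) =
    fun x : 'rV[R]_n => \sum_j (x 0 j - y 0 j) * (lin1_mx f) j i); last first.
    by apply/funext => x; exact: coordE.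
  apply: (@continuous_big R) => [|j _ x]; first exact: pseudometric_normed_Zmodule.add_continuous.
  have xj : continuous (fun z : 'rV[R]_n => z 0 j) by exact: coord_continuous.
  exact: (cvgM (cvgB (xj x) (cvg_cst _)) (cvg_cst _)).
move=> x; apply: (@continuous_comp _ _ _
  (fun x : 'rV[R]_n => dotv (f (x - y)) (f (x - y))) Num.sqrt); last first.
  exact: sqrt_continuous.
apply: (@continuous_big R) => [|i _ z]; first exact: pseudometric_normed_Zmodule.add_continuous.
exact: (cvgM (coordC i z) (coordC i z)).
Qed.

Lemma closed_slab {R : realType} {n : nat} (f : 'End('rV[R]_n)) (y : 'rV[R]_n)
  (r : R) : closed [set x : 'rV[R]_n | enorm (f (x - y)) <= r].
Proof.
apply: (@preimage_closed _ _ (fun x : 'rV[R]_n => enorm (f (x - y)))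
  [set z | z <= r]); last exact: closed_le.
by move=> x _; exact: enorm_lin_continuous.
Qed.

Lemma compact_enorm_bounded {R : realType} {n : nat} (E : set 'rV[R]_n) :
  compact E -> exists2 D : R, 0 < D & forall x y, E x -> E y -> enorm (x - y) <= D.
Proof.
move=> cE; have [->|/set0P E0] := eqVneq E set0; first by exists 1.
have enC : {within E, continuous (@enorm R n)}.
  apply: continuous_subspaceT => x.
  have -> : @enorm R n = fun x : 'rV[R]_n => enorm ((\1%VF : 'End('rV[R]_n)) (x - 0)).
    by apply/funext => z; rewrite subr0 id_lfunE.
  exact: enorm_lin_continuous.
have [c _ cmax] := compact_EVT_max E0 cE enC.
exists (2 * enorm c + 1); first by rewrite ltr_wpDl// mulr_ge0// enorm_ge0.
move=> x y /mem_set/cmax xc /mem_set/cmax yc.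
by have := enormD x (- y); rewrite enormN; lra.
Qed.

Lemma closed_borel {R : realType} {n : nat} (A : set 'rV[R]_n) :
  closed A -> measurable (A : set (borel_rV R n)).
Proof.
move=> cA; rewrite -(setCK A); apply: measurableC; apply: sub_sigma_algebra.
exact: closed_openC.
Qed.

(** The integral of a nonnegative function is a supremum over simple functions,
    so that comparing with a simple minorant suffices, whether or not g is
    measurable.  It is applied to inner integrals of the energy, as functions
    of y. *)
Lemma sum_measure_le_integral {R : realType} {d} {T : measurableType d}
    (mu : {measure set T -> \bar R}) (I : finType) (a : I -> R)
    (S : I -> set T) (g : T -> \bar R) :
  (forall i, 0 <= a i) -> (forall i, measurable (S i)) ->
  (forall y, ((\sum_i a i * \1_(S i) y)%:E <= g y)%E) ->
  (\sum_i (a i)%:E * mu (S i) <= \int[mu]_y g y)%E.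
Proof.
move=> a0 mS ag.
have f0 y : (0 <= (\sum_i a i * \1_(S i) y)%:E)%E.
  by rewrite lee_fin sumr_ge0// => i _; rewrite mulr_ge0.
have g0 y : (0 <= g y)%E by exact: le_trans (ag y).
have -> : (\sum_i (a i)%:E * mu (S i) =
    \int[mu]_y (\sum_i a i * \1_(S i) y)%:E)%E.
  under eq_integral do rewrite -sumEFin.
  rewrite ge0_integral_sum//; last first.
    by move=> i y _; rewrite lee_fin mulr_ge0.
    move=> i; apply/measurable_EFinP; apply: measurable_funM => //.
  apply: eq_bigr => i _.
  under eq_integral do rewrite EFinM.
  rewrite ge0_integralZl_EFin//; last first.
    by apply/measurable_EFinP.
  by rewrite integral_indic// setIT.
rewrite ge0_integralTE// ge0_integralTE//.
apply: ereal_sup_le => _ [h /= hf <-]; exists h => //= x.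
exact: le_trans (hf x) (ag x).
Qed.

(** Pieces of a cover may be replaced by their closures, which are Borel sets. *)
Lemma closure_pairwise {R : realType} {n : nat} (f : 'End('rV[R]_n)) (r : R)
    (A : set 'rV[R]_n) :
  (forall x y, A x -> A y -> enorm (f (x - y)) <= r) ->
  forall x y, closure A x -> closure A y -> enorm (f (x - y)) <= r.
Proof.
move=> Ar x y Ax Ay.
have closA (z : 'rV[R]_n) : (forall u, A u -> enorm (f (u - z)) <= r) ->
    forall u, closure A u -> enorm (f (u - z)) <= r.
  move=> Az u; rewrite closureEbigcap => /(_ [set v | enorm (f (v - z)) <= r]).
  by apply; split; [exact: closed_slab|exact: Az].
apply: (closA) => // u Au; rewrite -opprB linearN enormN.
by apply: closA => // v Av; exact: Ar.
Qed.

(** The k <= M pieces of mass less than 1/(2M) have total mass at most 1/2, so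
    the other pieces carry at least 1/2.  Each of them lies in the slab around
    any of its points. *)
Lemma heavy_part {R : realType} {n k : nat} (mu : probability (borel_rV R n) R)
    (E : set 'rV[R]_n) (f : 'End('rV[R]_n)) (r M : R)
    (U : 'I_k -> set 'rV[R]_n) :
  closed E -> probs_on E mu ->
  (forall i x y, U i x -> U i y -> enorm (x - y) <= r) ->
  (forall x, E x -> exists i, U i (f x)) -> k%:R <= M -> 0 < M ->
  exists S : set 'rV[R]_n, [/\ measurable (S : set (borel_rV R n)), S `<=` E,
    ((2^-1)%:E <= mu S)%E &
    forall y, S y ->
      (((2 * M)^-1)%:E <= mu (E `&` [set x : 'rV[R]_n | enorm (f (x - y)) <= r]%R))%E].
Proof.
move=> cE muE Ur EU kM M0.
pose Q i := closure (E `&` f @^-1` U i).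
have cQ i : closed (Q i) by exact: closed_closure.
have mQ i : measurable (Q i : set (borel_rV R n)) by exact: closed_borel.
have QE i : Q i `<=` E.
  by rewrite [X in _ `<=` X](closure_id E).1//; apply: closureS => x [].
have Qr i x y : Q i x -> Q i y -> enorm (f (x - y)) <= r.
  apply: closure_pairwise => u v [_ Uu] [_ Uv]; rewrite linearB.
  exact: Ur Uu Uv.
have EQ x : E x -> exists i, Q i x.
  by move=> Ex; have [i Ui] := EU x Ex; exists i; apply: subset_closure.
pose c := (2 * M)^-1.
have c0 : 0 < c by rewrite invr_gt0 mulr_gt0.
pose heavy i := (c%:E <= mu (Q i))%E.
pose S : set (borel_rV R n) := \big[setU/set0]_(i < k | heavy i) Q i.
pose B : set (borel_rV R n) := \big[setU/set0]_(i < k | ~~ heavy i) Q i.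
have mS : measurable S by exact: bigsetU_measurable.
have [mB muB] : measurable B /\ (mu B <= (\sum_(i < k | ~~ heavy i) c)%:E)%E.
  rewrite /B -sumEFin; elim/big_rec2 : _ => [|i x A hi [mA Ax]].
    by split => //; rewrite measure0.
  split; first exact: measurableU.
  apply: le_trans (measureU2 _ (mQ i) mA) _; apply: leeD => //.
  by move: hi; rewrite -ltNge => /ltW.
have {}muB : (mu B <= (2^-1)%:E)%E.
  apply: le_trans muB _; rewrite lee_fin.
  apply: (@le_trans _ _ (\sum_(i < k) c)).
    by rewrite [leRHS](bigID heavy)/= lerDr sumr_ge0// => i _; exact: ltW.
  rewrite sumr_const card_ord -[leLHS]mulr_natl /c invfM mulrCA ger_pMr ?invr_gt0//.
  by rewrite ler_pdivrMr// mul1r.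
have SP x : S x -> exists2 i, heavy i & Q i x.
  by rewrite /S -bigcup_pred; case=> i /= hi Qi; exists i.
exists S; split => //.
- by move=> x /SP[i _ /QE].
- have cover : [set: borel_rV R n] `<=` ~` E `|` (S `|` B).
    move=> x _; have [Ex|] := pselect (E x); last by left.
    right; have [i Qi] := EQ x Ex.
    by have [hi|hi] := boolP (heavy i); [left|right];
      rewrite /S /B -bigcup_pred; exists i.
  have mE : measurable (~` E : set (borel_rV R n)).
    by apply: measurableC; exact: closed_borel.
  have : (1 <= mu S + (2^-1)%:E)%E.
    rewrite -(probability_setT mu).
    apply: le_trans (le_measure _ _ _ cover) _; rewrite ?inE//.
      by apply: measurableU => //; exact: measurableU.
    apply: le_trans (measureU2 _ mE (measurableU _ _ mS mB)) _.
    rewrite -[leRHS]add0e; apply: leeD; first by rewrite le_eqVlt; apply/orP; left; apply/eqP.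
    by apply: le_trans (measureU2 _ mS mB) _; apply: leeD.
  have -> : mu S = (fine (mu S))%:E by rewrite fineK// fin_num_measure.
  by rewrite -EFinD !lee_fin; lra.
- move=> y /SP[i hi Qy]; apply: le_trans hi _; apply: le_measure; rewrite ?inE//.
    apply: measurableI; first exact: closed_borel.
    by apply: closed_borel; exact: closed_slab.
  by move=> x Qx; split; [exact: QE Qx|exact: Qr Qx Qy].
Qed.

Lemma phi_ge0 {R : realType} {n : nat} (r s : R) (x : 'rV[R]_n) : 0 <= phi r s x.
Proof. by rewrite /phi; case: ifP => // _; rewrite le_min ler01 powR_ge0. Qed.

(** With diameters at most r, and not equal to r, this is monotone in r, which
    allows scales to be rounded up to powers of 1/2. *)
Definition few_pieces {R : realType} {n : nat} (r M : R) (A : set 'rV[R]_n) : Prop :=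
  exists (k : nat) (U : 'I_k -> set 'rV[R]_n), [/\ k%:R <= M,
    forall i x y, U i x -> U i y -> enorm (x - y) <= r &
    forall x, A x -> exists i, U i x].

(** The inner integral of the energy at y is at least 1/C times the sum of
    w_i mu(slab_i(y)), and mu(slab_i(y)) >= 1/(2M) for y in a set of mass at
    least 1/2. *)
Lemma sum_weights_le_energy {R : realType} {n m : nat}
    (mu : probability (borel_rV R n) R) (E : set 'rV[R]_n) (r s M C : R)
    (I : finType) (p : I -> grassmannian R n m) (w : I -> R) :
  closed E -> probs_on E mu -> 0 < M -> 0 < C -> (forall i, 0 <= w i) ->
  (forall x y, E x -> E y ->
    \sum_(i | enorm (orthoproj (sval (p i)) (x - y)) <= r) w i
      <= C * phi r s (x - y)) ->
  (forall i, few_pieces r M (orthoproj (sval (p i)) @` E)) ->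
  ((\sum_i w i / (4 * M * C))%:E <= energy r s mu)%E.
Proof.
move=> cE muE M0 C0 w0 wphi pieces.
pose f i := orthoproj (sval (p i)).
pose c : R := (2 * M)^-1.
have c0 : 0 <= c by rewrite invr_ge0 mulr_ge0 ?(ltW M0).
pose slab i y := E `&` [set x : 'rV[R]_n | enorm (f i (x - y)) <= r].
have [S SP] : {S : I -> set 'rV[R]_n & forall i,
    [/\ measurable (S i : set (borel_rV R n)), S i `<=` E,
    ((2^-1)%:E <= mu (S i))%E &
    forall y, S i y -> (c%:E <= mu (slab i y))%E]}.
  apply: (@choice _ _ (fun i S => [/\ measurable (S : set (borel_rV R n)),
    S `<=` E, ((2^-1)%:E <= mu S)%E &
    forall y, S y -> (c%:E <= mu (slab i y))%E])) => i.
  have [k [U [kM Ur EU]]] := pieces i.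
  apply: (heavy_part mu E (f i) r M U cE muE Ur) => // x Ex.
  by apply: EU; exists x.
have wC i : 0 <= w i / C by rewrite divr_ge0// ltW.
have Phi0 y : (0 <= \int[mu]_x (phi r s ((x : 'rV[R]_n) - y))%:E)%E.
  by apply: integral_ge0 => x _; rewrite lee_fin phi_ge0.
have inner y : ((\sum_i (w i / C * c) * \1_(S i) y)%:E <=
    \int[mu]_x (phi r s ((x : 'rV[R]_n) - y))%:E)%E.
  have [Ey|nEy] := pselect (E y); last first.
    rewrite big1// => i _; rewrite indicE memNset ?mulr0// => Sy.
    by have [_ SE _ _] := SP i; apply: nEy; exact: SE.
  apply: (@le_trans _ _ (\sum_i (w i / C)%:E * mu (slab i y))%E).
    rewrite -sumEFin; apply: lee_sum => i _.
    rewrite -mulrA EFinM; apply: lee_wpmul2l; first by rewrite lee_fin.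
    have [_ _ _ Sc] := SP i.
    have [Sy|nSy] := pselect (S i y); rewrite indicE.
      by rewrite mem_set// mulr1; exact: Sc.
    by rewrite memNset// mulr0 measure_ge0.
  apply: sum_measure_le_integral => // [i|x].
    apply: measurableI; first exact: closed_borel.
    by apply: closed_borel; exact: closed_slab.
  rewrite lee_fin; have [Ex|nEx] := pselect (E x); last first.
    rewrite big1 ?phi_ge0// => i _; rewrite indicE memNset ?mulr0//.
    by case.
  rewrite -(ler_pM2l C0); apply: le_trans (wphi x y Ex Ey).
  rewrite mulr_sumr [leRHS]big_mkcond/=; apply: ler_sum => i _.
  rewrite indicE (mulrA C) (mulrC C) divfK ?gt_eqF//.
  case: ifPn => h.
    by rewrite ler_piMr// lern1 leq_b1.
  by rewrite memNset ?mulr0// => -[_ h']; rewrite /f h' in h.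
apply: (@le_trans _ _ (\sum_i (w i / C * c)%:E * mu (S i))%E); last first.
  apply: sum_measure_le_integral => // i; first by rewrite mulr_ge0.
  by have [] := SP i.
rewrite -sumEFin; apply: lee_sum => i _.
have [_ _ muS _] := SP i.
apply: (@le_trans _ _ ((w i / C * c)%:E * (2^-1)%:E)%E); last first.
  by apply: lee_wpmul2l => //; rewrite lee_fin mulr_ge0.
rewrite -EFinM lee_fin le_eqVlt; apply/orP; left; apply/eqP.
rewrite /c; field.
by rewrite !gt_eqF.
Qed.

(** * Content of the bad subspaces at one scale *)

(** The hypotheses on the bad subspaces are used at the points of the net, which
    must therefore lie in F: one representative is chosen in each class of
    [grass_net] that meets F. *)
Lemma net_representatives {R : realType} {n m : nat} (F : set (grassmannian R n m))
    (r : R) : 0 < r ->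
  exists (I : finType) (p : I -> grassmannian R n m),
    (forall i, F (p i)) /\ forall V, F V -> exists i, grass_dist (p i) V <= r.
Proof.
move=> r0; have [K [key keyP]] := @grass_net R n m r r0.
pose P k := `[< exists2 V, F V & key V = k >].
have [p pP] : {p : {k | P k} -> grassmannian R n m & forall i, F (p i) /\ key (p i) = val i}.
  apply: (@choice _ _ (fun (i : {k | P k}) V => F V /\ key V = val i)) => -[k Pk].
  by have /asboolP[V FV Vk] := Pk; exists V.
exists {k | P k}, p; split => [i|V FV]; first by have [] := pP i.
have Pk : P (key V) by apply/asboolP; exists V.
pose i : {k | P k} := Sub (key V) Pk.
by exists i; apply: keyP; have [] := pP i.
Qed.

(** The smallness assumption on C M e only ensures that the covering balls,
    whose diameters are at most (C M e)^(1/t), have diameter at most delta. *)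
Lemma few_pieces_coverable {R : realType} (n m : nat) (s t : R) (E : set 'rV[R]_n) :
  (m < n)%N -> 0 <= s -> (m * (n - m - 1))%:R + s <= t -> 0 < t -> compact E ->
  exists2 C : R, 0 < C & forall (r M e delta : R) (mu : probability (borel_rV R n) R),
    0 < r <= 1 -> 0 < M -> probs_on E mu -> (energy r s mu <= e%:E)%E ->
    0 < delta -> C * (M * e) <= delta `^ t ->
    coverable (@grass_dist R n m) t delta (C * (M * e))
      [set V | few_pieces r M (orthoproj (sval V) @` E)].
Proof.
move=> mn s0 st t0 cE.
have clE : closed E by apply: compact_closed cE; exact: norm_hausdorff.
have [D D0 ED] := compact_enorm_bounded E cE.
have [C1 C10 slabC] := slab_weight n m s t D mn s0 st D0.
exists (8 `^ t * (4 * C1)) => [|r M e delta mu /andP[r0 r1] M0 muE mue delta0 small].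
  by rewrite !mulr_gt0// powR_gt0.
set F := [set V | _].
have [I [p [Fp pnet]]] := net_representatives F r r0.
have [w [w0 wreg [K [c [rad [rrad radw cov]]]]]] :=
  finite_frostman R I (fun i j => grass_dist (p i) (p j)) t r
    (fun i => grass_distxx _) (fun i j => grass_distC _ _)
    (fun i j k => grass_dist_triangle _ _ _) (ltW t0) r0.
have wle : \sum_i w i <= 4 * C1 * (M * e).
  have := sum_weights_le_energy mu E r s M C1 I p w
    clE muE M0 C10 w0.
  have slabs x y : E x -> E y ->
      \sum_(i | enorm (orthoproj (sval (p i)) (x - y)) <= r) w i
      <= C1 * phi r s (x - y).
    by move=> Ex Ey; apply: slabC (ED _ _ Ex Ey); rewrite ?r0.
  move=> /(_ slabs Fp) /le_trans /(_ mue).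
  rewrite lee_fin -mulr_suml ler_pdivrMr ?mulr_gt0//.
  by move/le_trans; apply; rewrite le_eqVlt; apply/orP; left; apply/eqP; ring.
have rad0 k : 0 <= rad k by rewrite (le_trans (ltW r0)).
have sum8 : \sum_k (8 * rad k) `^ t <= 8 `^ t * (4 * C1) * (M * e).
  under eq_bigr => k _ do rewrite powRM//.
  rewrite -mulr_sumr -mulrA ler_wpM2l ?powR_ge0//.
  exact: le_trans radw wle.
apply: (coverable_fin _ _ _ _ _ K
  (fun k => [set V | grass_dist (p (c k)) V <= 4 * rad k]) (fun k => 8 * rad k)).
- exact: ltW.
- exact: ltW.
- move=> k; rewrite mulr_ge0//= leNgt; apply/negP => dk.
  have : delta `^ t < (8 * rad k) `^ t.
    by rewrite gt0_ltr_powR// nnegrE ?(ltW delta0)// mulr_ge0.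
  apply/negP; rewrite -leNgt; apply: le_trans small; apply: le_trans sum8.
  rewrite (bigD1 k)//= lerDl sumr_ge0// => i _; exact: powR_ge0.
- move=> k V W /= Vk Wk.
  apply: le_trans (grass_dist_triangle V (p (c k)) W) _.
  rewrite (grass_distC V (p (c k))).
  have -> : 8 * rad k = 4 * rad k + 4 * rad k by ring.
  exact: (lerD Vk Wk).
- move=> V FV; have [i iV] := pnet V FV; have [k ki] := cov i.
  exists k => //=; apply: le_trans (grass_dist_triangle (p (c k)) (p i) V) _.
  have -> : 4 * rad k = 3 * rad k + rad k by ring.
  by rewrite lerD// (le_trans iV).
- exact: sum8.
Qed.

(** At scale r_k the content is O(r_k^-a r_k^b), which is at most O(q^k) with
    q = 2^-(b-a) < 1. *)
Lemma limsup_few_pieces_null {R : realType} (n m : nat) (s t a b L : R)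
    (E : set 'rV[R]_n) (r : nat -> R) (mu : nat -> probability (borel_rV R n) R)
    (A : set (grassmannian R n m)) (delta eps : R) :
  (m < n)%N -> 0 <= s -> (m * (n - m - 1))%:R + s <= t -> 0 < t -> compact E ->
  a < b -> 0 < L ->
  (forall k, 0 < r k <= 2^-1 ^+ k) -> (forall k, probs_on E (mu k)) ->
  (forall k, (energy (r k) s (mu k) <= (r k `^ b)%:E)%E) ->
  (forall V, A V -> forall N, exists2 k, (N <= k)%N &
     few_pieces (r k) (L * r k `^ (- a)) (orthoproj (sval V) @` E)) ->
  0 < delta -> 0 < eps -> coverable (@grass_dist R n m) t delta eps A.
Proof.
move=> mn s0 st t0 cE ab L0 rP muE mue AV delta0 eps0.
have [C C0 CP] := few_pieces_coverable n m s t E mn s0 st t0 cE.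
pose q : R := 2^-1 `^ (b - a).
have q01 : 0 < q < 1.
  rewrite powR_gt0 ?invr_gt0//=.
  have <- : 1 `^ (b - a) = 1 :> R by rewrite powR1.
  rewrite gt0_ltr_powR ?nnegrE ?subr_gt0 ?invr_ge0//.
  by rewrite invf_lt1// ltr1n.
apply: (coverable_limsup _ t (C * L) q delta eps
  (fun k => [set V | few_pieces (r k) (L * r k `^ (- a)) (orthoproj (sval V) @` E)])) => //.
  by rewrite mulr_ge0// ltW.
move=> k small; have /andP[rk0 rk1] := rP k.
have le : C * (L * r k `^ (- a) * r k `^ b) <= C * L * q ^+ k.
  rewrite -!mulrA ler_wpM2l ?(ltW C0)// ler_wpM2l ?(ltW L0)//.
  rewrite -powRD ?(gt_eqF rk0) ?implybT// addrC /q.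
  have -> : (2^-1 `^ (b - a)) ^+ k = (2^-1 ^+ k) `^ (b - a) :> R.
    rewrite -(powR_mulrn k (powR_ge0 _ _)) -powRrM mulrC powRrM.
    by rewrite powR_mulrn ?invr_ge0.
  rewrite ge0_ler_powR ?nnegrE ?(ltW rk0) ?exprn_ge0 ?invr_ge0//.
  by rewrite subr_ge0 ltW.
have [||U [FU dU sU]] := CP (r k) (L * r k `^ (- a)) (r k `^ b) delta (mu k) _ _
  (muE k) (mue k) delta0 (le_trans le small).
- by rewrite rk0 (le_trans rk1)// exprn_ile1 ?invr_ge0// invf_le1// ler1n.
- by rewrite mulr_gt0// powR_gt0.
by exists U; split => //; apply: le_trans sU _; rewrite lee_fin.
Qed.

(** * Upper and lower limits of logarithmic ratios *)

Lemma limf_esup_lt {R : realType} (f : R -> \bar R) (a : \bar R) :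
  (limf_esup f 0^'+ < a)%E ->
  exists2 e : R, 0 < e & forall r, 0 < r < e -> (f r < a)%E.
Proof.
rewrite limf_esupE => /ereal_inf_lt[_ [V V0 <-] supV].
have [e /= e0 eV] := V0; exists e => // r /andP[r0 re].
apply: le_lt_trans supV; apply: ereal_sup_ubound; exists r => //.
by apply: eV => //=; rewrite sub0r normrN gtr0_norm.
Qed.

Lemma lt_limf_esup {R : realType} (f : R -> \bar R) (b : \bar R) :
  (b < limf_esup f 0^'+)%E ->
  forall e : R, 0 < e -> exists2 r, 0 < r < e & (b < f r)%E.
Proof.
rewrite limf_esupE => bf e e0.
have : (b < ereal_sup (f @` [set r | (0 < r < e)%R]))%E.
  apply: lt_le_trans bf _; apply: ereal_inf_lbound; exists [set r | 0 < r < e] => //.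
  exists e => //= r; rewrite /= sub0r normrN => re r0.
  by rewrite r0 (le_lt_trans (ler_norm _) re).
by move=> /ereal_sup_gt[_ [r /= re <-] br]; exists r.
Qed.

Lemma lt_limf_einf {R : realType} (f : R -> \bar R) (b : \bar R) :
  (b < limf_einf f 0^'+)%E ->
  exists2 e : R, 0 < e & forall r, 0 < r < e -> (b < f r)%E.
Proof.
rewrite /limf_einf lteNr => /limf_esup_lt[e e0 eP].
by exists e => // r /eP; rewrite lteN2.
Qed.

Lemma limf_einf_lt {R : realType} (f : R -> \bar R) (a : \bar R) :
  (limf_einf f 0^'+ < a)%E ->
  forall e : R, 0 < e -> exists2 r, 0 < r < e & (f r < a)%E.
Proof.
rewrite /limf_einf lteNl => /lt_limf_esup aP e /aP[r re].
by rewrite lteN2; exists r.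
Qed.

Lemma lne_div_lt {R : realType} (y : \bar R) (L a : R) : 0 < L -> (0 <= y)%E ->
  (lne y / L%:E < a%:E)%E = (y < (expR (a * L))%:E)%E.
Proof.
move=> L0; rewrite inver gt_eqF//; case: y => [v|_|//]; last first.
  by rewrite /= gt0_mulye ?lte_fin ?invr_gt0.
rewrite lee_fin le_eqVlt => /predU1P[<-|v0].
  by rewrite lte_fin expR_gt0 le0_lneNy// gt0_mulNye ?ltNyr// lte_fin invr_gt0.
rewrite lne_EFin// -EFinM !lte_fin ltr_pdivrMr// -[in RHS](lnK v0).
by rewrite ltr_expR.
Qed.

Lemma lt_lne_div {R : realType} (y : \bar R) (L a : R) : 0 < L -> (0 <= y)%E ->
  (a%:E < lne y / L%:E)%E = ((expR (a * L))%:E < y)%E.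
Proof.
move=> L0; rewrite inver gt_eqF//; case: y => [v|_|//]; last first.
  by rewrite /= gt0_mulye ?lte_fin ?invr_gt0// !ltry.
rewrite lee_fin le_eqVlt => /predU1P[<-|v0].
  rewrite le0_lneNy// gt0_mulNye ?lte_fin ?invr_gt0//.
  by rewrite !ltNge leNye (ltW (expR_gt0 _)).
rewrite lne_EFin// -EFinM !lte_fin ltr_pdivlMr// -[in RHS](lnK v0).
by rewrite ltr_expR.
Qed.

Lemma expR_powR {R : realType} (r a : R) : 0 < r ->
  expR (a * - ln r) = r `^ (- a).
Proof. by move=> r0; rewrite /powR gt_eqF// mulrN mulNr. Qed.

Lemma few_pieces_of_covering_number {R : realType} {n : nat} (r a : R)
    (A : set 'rV[R]_n) : 0 < r < 1 ->
  (lne (covering_number r A) / (- ln r)%:E < a%:E)%E ->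
  few_pieces r (r `^ (- a)) A.
Proof.
move=> /andP[r0 r1]; have L0 : 0 < - ln r by rewrite oppr_gt0 ln_lt0// r0.
rewrite lne_div_lt//; last by apply: le_ereal_inf_tmp => _ [k _ <-]; rewrite lee_fin.
move=> /ereal_inf_lt[_ [k [U [dU AU]] <-]].
rewrite lte_fin expR_powR// => kr; exists k, U; split => //; first exact: ltW.
move=> i x y Ux Uy; rewrite -lee_fin -(dU i); apply: ereal_sup_ubound.
by right; exists (x, y).
Qed.

Lemma energy_le_of_capacity {R : realType} {n : nat} (r s b : R)
    (E : set 'rV[R]_n) : 0 < r < 1 ->
  (b%:E < lne (capacity r s E) / (- ln r)%:E)%E ->
  exists2 mu, probs_on E mu & (energy r s mu <= (r `^ b)%:E)%E.
Proof.
move=> /andP[r0 r1]; have L0 : 0 < - ln r by rewrite oppr_gt0 ln_lt0// r0.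
have energy0 mu : (0 <= energy r s mu)%E.
  by apply: integral_ge0 => y _; apply: integral_ge0 => x _; rewrite lee_fin phi_ge0.
set I := ereal_inf [set energy r s mu | mu in probs_on E].
have I0 : (0 <= I)%E by apply: le_ereal_inf_tmp => _ [mu _ <-].
rewrite lt_lne_div ?inve_ge0// expR_powR//.
have rb0 : 0 < r `^ b by rewrite powR_gt0.
have -> : capacity r s E = I^-1%E by [].
move=> cap; have : (I < (r `^ b)%:E)%E.
  move: I0 cap; case: I => [v| |] //; last first.
    by rewrite invey lte_fin ltNge powR_ge0.
  rewrite lee_fin inver le_eqVlt => /predU1P[<- _|v0]; first by rewrite lte_fin.
  by rewrite gt_eqF// !lte_fin powRN ltf_pV2 ?posrE.
by move=> /ereal_inf_lt[_ [mu muE <-] /ltW le]; exists mu.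
Qed.

(** * Exceptional sets *)

Lemma half_exp_lt {R : realType} (e : R) : 0 < e ->
  exists N, forall k, (N <= k)%N -> 2^-1 ^+ k < e.
Proof.
move=> e0; have half1 : `|2^-1 : R| < 1.
  by rewrite ger0_norm ?invr_ge0// invf_lt1// ltr1n.
have /cvgrPdist_lt /(_ _ e0)[N _ NP] := cvg_geometric 1 half1.
by exists N => k /NP /=; rewrite sub0r normrN mul1r ger0_norm.
Qed.

Lemma powRN_le_scale {R : realType} (a x y : R) :
  0 < x -> y / 2 <= x -> x <= y -> x `^ (- a) <= 2 `^ `|a| * y `^ (- a).
Proof.
move=> x0 yx xy; have y0 : 0 < y by exact: lt_le_trans xy.
have z0 : 0 < x / y by rewrite divr_gt0.
have -> : x = (x / y) * y by rewrite divfK// gt_eqF.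
rewrite powRM ?(ltW z0) ?(ltW y0)// ler_wpM2r ?powR_ge0//.
apply: (@le_trans _ _ ((x / y) `^ (- `|a|))).
  by rewrite ger_powR ?z0/= ?ler_pdivrMr ?mul1r// lerN2 ler_norm.
rewrite powRN -powR_inv1 ?powR_ge0// powRAC powR_inv1 ?(ltW z0)//.
rewrite ge0_ler_powR ?nnegrE ?invr_ge0 ?(ltW z0)// -(invrK 2) lef_pV2 ?posrE//.
by rewrite ler_pdivlMr// mulrC.
Qed.

Lemma few_pieces_le {R : realType} {n : nat} (r r' M M' : R) (A : set 'rV[R]_n) :
  r <= r' -> M <= M' -> few_pieces r M A -> few_pieces r' M' A.
Proof.
move=> rr MM [k [U [kM Ur AU]]]; exists k, U; split => //.
  exact: le_trans MM.
by move=> i x y Ux Uy; apply: le_trans (Ur i x y Ux Uy) rr.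
Qed.

Section exceptional_sets.
Context {R : realType} (n m : nat) (s t a b : R) (E : set 'rV[R]_n).
Hypotheses (mn : (m < n)%N) (s0 : 0 <= s) (st : (m * (n - m - 1))%:R + s <= t).
Hypotheses (t0 : 0 < t) (cE : compact E) (ab : a < b).

(** The scales r_k are chosen so that the capacity exceeds r_k^-b, independently
    of V; the upper box dimension controls all sufficiently small scales. *)
Lemma upper_null (delta eps : R) : (b%:E < upper_profile s E)%E ->
  0 < delta -> 0 < eps ->
  coverable (@grass_dist R n m) t delta eps
    [set V | (upper_box_dim (orthoproj (sval V) @` E) < a%:E)%E].
Proof.
move=> bP delta0 eps0.
have half0 k : 0 < 2^-1 ^+ k :> R by rewrite exprn_gt0// invr_gt0.
have half1 k : 2^-1 ^+ k <= 1 :> R.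
  by rewrite exprn_ile1 ?invr_ge0// invf_le1// ler1n.
have [F FP] : {F : nat -> R * probability (borel_rV R n) R & forall k,
    [/\ 0 < (F k).1 < 2^-1 ^+ k, probs_on E (F k).2 &
    (energy (F k).1 s (F k).2 <= ((F k).1 `^ b)%:E)%E]}.
  apply: (@choice _ _ (fun k (F : R * probability (borel_rV R n) R) =>
    [/\ 0 < F.1 < 2^-1 ^+ k, probs_on E F.2 &
    (energy F.1 s F.2 <= (F.1 `^ b)%:E)%E])) => k.
  have [r /andP[r0 rk] br] := lt_limf_esup _ _ bP _ (half0 k).
  have [|mu muE mue] := energy_le_of_capacity r s b E _ br.
    by rewrite r0 (lt_le_trans rk).
  by exists (r, mu); rewrite /= r0 rk.
apply: (limsup_few_pieces_null n m s t a b 1 E (fun k => (F k).1)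
  (fun k => (F k).2)) => // [k|k|k|V VA N].
- by have [/andP[-> /ltW rk] _ _] := FP k.
- by have [_ muE _] := FP k.
- by have [_ _ mue] := FP k.
have [e e0 eP] := limf_esup_lt _ _ VA.
have [N1 N1P] := half_exp_lt _ e0.
exists (maxn N N1); first exact: leq_maxl.
have [/andP[r0 r1] _ _] := FP (maxn N N1).
rewrite mul1r; apply: few_pieces_of_covering_number.
  by rewrite r0 (lt_le_trans r1).
by apply: eP; rewrite r0 (lt_trans r1)// N1P// leq_maxr.
Qed.

(** Here all small scales are available for the energy, so r_k runs through
    powers of 1/2.  The scale u at which the projection has a good cover
    depends on V, and is rounded up to the next r_k. *)
Lemma lower_null (delta eps : R) : (b%:E < lower_profile s E)%E ->
  0 < delta -> 0 < eps ->
  coverable (@grass_dist R n m) t delta eps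
    [set V | (lower_box_dim (orthoproj (sval V) @` E) < a%:E)%E].
Proof.
move=> bP delta0 eps0.
have half0 k : 0 < 2^-1 ^+ k :> R by rewrite exprn_gt0// invr_gt0.
have half01 : 0 <= (2^-1 : R) <= 1 by rewrite invr_ge0 invf_le1// ler0n ler1n.
have halfS k : 2^-1 ^+ k.+1 < 1 :> R.
  by rewrite exprn_ilt1 ?invr_ge0// invf_lt1// ltr1n.
have half_le (j k : nat) : (j <= k)%N -> 2^-1 ^+ k <= 2^-1 ^+ j :> R.
  by have /andP[h0 h1] := half01; move=> jk; exact: ler_wiXn2l.
have [e e0 eP] := lt_limf_einf _ _ bP.
have [k0 k0P] := half_exp_lt _ e0.
pose r k : R := 2^-1 ^+ (k + k0.+1).
have r0 k : 0 < r k by exact: half0.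
have r1 k : r k < 1 by rewrite /r addnS.
have [mu muP] : {mu : nat -> probability (borel_rV R n) R & forall k,
    probs_on E (mu k) /\ (energy (r k) s (mu k) <= (r k `^ b)%:E)%E}.
  apply: (@choice _ _ (fun k mu => probs_on E mu /\
    (energy (r k) s mu <= (r k `^ b)%:E)%E)) => k.
  have [||mu muE mue] := energy_le_of_capacity (r k) s b E; last by exists mu.
    by rewrite r0 r1.
  by apply: eP; rewrite r0 k0P// addnS -addSn leq_addl.
apply: (limsup_few_pieces_null n m s t a b (2 `^ `|a|) E r mu) => // [k|k|k|V VA N].
- by rewrite r0 half_le// leq_addr.
- by have [] := muP k.
- by have [] := muP k.
have [u /andP[u0 ur] ua] := limf_einf_lt _ _ VA _ (r0 N).
(* With j minimal, 2^-j < u <= 2^-(j-1), and r_k = 2^-(j-1) for the k below. *)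
have [|j ju jmin] := @ex_minnP (fun j => 2^-1 ^+ j < u).
  by have [j jP] := half_exp_lt _ u0; exists j; exact: jP.
have jN : (N + k0.+1 < j)%N.
  rewrite ltnNge; apply/negP => /half_le /(lt_le_trans ur).
  by rewrite ltNge (ltW ju).
pose k := (j.-1 - k0.+1)%N.
have j0 : (0 < j)%N by exact: leq_ltn_trans jN.
have k0j : (k0.+1 <= j.-1)%N.
  by rewrite -ltnS prednK// (leq_ltn_trans _ jN)// leq_addl.
have rk : r k = 2^-1 ^+ j.-1 by rewrite /r subnK.
exists k; first by rewrite leq_subRL// -ltnS prednK// addnC.
have urk : u <= r k.
  by rewrite rk leNgt; apply/negP => /jmin; rewrite leqNgt prednK// leqnn.
apply: (few_pieces_le _ _ _ _ _ urk); last first.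
  by apply: few_pieces_of_covering_number ua; rewrite u0 (lt_trans ur).
apply: powRN_le_scale => //; rewrite rk -exprSr prednK ?ltW//.
Qed.

End exceptional_sets.

Lemma rat_between_ereal {R : realType} (u v : \bar R) : (u < v)%E ->
  exists a b : rat, [/\ a < b, (u < (ratr a)%:E)%E & ((ratr b)%:E < v)%E].
Proof.
move=> uv.
have [c [d [cd uc dv]]] : exists c d : R, [/\ c < d, (u <= c%:E)%E & (d%:E <= v)%E].
  case: u v uv => [u| |] [v| |] //.
  - by rewrite lte_fin => uv; exists u, v; rewrite !lee_fin.
  - by exists u, (u + 1); rewrite lee_fin leey ltrDl.
  - by exists (v - 1), v; rewrite lee_fin leNye gtrBl.
  - by exists 0, 1; rewrite leNye leey.
have [b] := rat_in_itvoo cd; rewrite in_itv/= => /andP[cb bd].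
have [a] := rat_in_itvoo cb; rewrite in_itv/= => /andP[ca ab].
exists a, b; split; first by rewrite -(ltr_rat R).
  by apply: le_lt_trans uc _; rewrite lte_fin.
by apply: lt_le_trans dv; rewrite lte_fin.
Qed.

(** Rational numbers a < b separate B x from P, which makes the exceptional set
    a countable union of null sets. *)
Lemma hausdorff_dim_lt_le {R : realType} {T : Type} (d : T -> T -> R)
    (B : T -> \bar R) (P : \bar R) (D : R) : 0 <= D ->
  (forall t a b, D < t -> a < b -> (b%:E < P)%E -> forall delta eps,
     0 < delta -> 0 < eps -> coverable d t delta eps [set x | (B x < a%:E)%E]) ->
  (hausdorff_dim d [set x | (B x < P)%E] <= D%:E)%E.
Proof.
move=> D0 cov; apply/lee_addgt0Pr => e e0; rewrite -EFinD.
apply: ereal_inf_lbound; exists (D + e) => //; split; first by rewrite addr_ge0// ltW.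
apply: hausdorff_measure_eq0 => delta eps delta0 eps0.
pose A q : set T := if unpickle q is Some (a, b) then
  [set x | [/\ (a : rat) < (b : rat), ((ratr b)%:E < P)%E & (B x < (ratr a)%:E)%E]]
  else set0.
apply: (@coverable_sub _ _ _ _ _ _ _ (\bigcup_q A q)).
  move=> x /rat_between_ereal[a [b [ab Ba bP]]].
  by exists (pickle (a, b)); [|rewrite /A pickleK].
apply: coverable_bigcup_null => // q eps' eps'0; rewrite /A.
have cov0 : coverable d (D + e) delta eps' set0.
  apply: (coverable_fin _ _ _ _ _ void (fun=> set0) (fun=> 0)) => //.
  - by rewrite addr_ge0// ltW.
  - exact: ltW.
  - by rewrite big1 ?ltW// => -[].
case: unpickle => [[a b]|//].
have [ab|nab] := boolP (a < b); last first.
  by apply: coverable_sub cov0 => x [].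
have [bP|nbP] := boolP ((ratr b)%:E < P)%E; last first.
  by apply: coverable_sub cov0 => x [_].
apply: coverable_sub (cov (D + e) (ratr a) (ratr b) _ _ bP delta eps' delta0 eps'0).
- by move=> x [].
- by rewrite ltrDl.
- by rewrite ltr_rat.
Qed.

Theorem theorem2p9 (R : realType) (n m : nat) (s : R) (E : set 'rV[R]_n)
    (m_ge1 : (1 <= m)%N) (m_le : (m <= n - 1)%N)
    (E_neq0 : E !=set0) (E_compact : compact E)
    (s_ge0 : 0 <= s) (s_le : s <= m%:R) :
  (hausdorff_dim (@grass_dist R n m)
     [set V : grassmannian R n m |
       upper_box_dim (orthoproj (sval V) @` E) < upper_profile s E]
   <= (m%:R * (n%:R - m%:R) - (m%:R - s))%:E)%E /\
  (hausdorff_dim (@grass_dist R n m)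
     [set V : grassmannian R n m |
       lower_box_dim (orthoproj (sval V) @` E) < lower_profile s E]
   <= (m%:R * (n%:R - m%:R) - (m%:R - s))%:E)%E.
Proof.
have mn : (m < n)%N by lia.
have DE : m%:R * (n%:R - m%:R) - (m%:R - s) = (m * (n - m - 1))%:R + s :> R.
  by rewrite natrM !natrB ?subn_gt0 ?(ltnW mn)//; ring.
have D0 : 0 <= (m * (n - m - 1))%:R + s :> R by rewrite addr_ge0.
rewrite DE; split; apply: hausdorff_dim_lt_le => // t a b Dt ab bP delta eps d0 e0.
  by apply: (upper_null n m s t a b E) => //; [exact: ltW|exact: le_lt_trans Dt].
by apply: (lower_null n m s t a b E) => //; [exact: ltW|exact: le_lt_trans Dt].
Qed.
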